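(* Let $G$ be a connected graph with $n$ vertices, where $n\geqslant 23$. Then for every integer $m\geqslant n/2$, the graph $G^{1/m}$ is locatable.
   Context: Graphs are finite and simple. For a positive integer $m$, $G^{1/m}$ denotes the graph obtained from $G$ by replacing each edge of $G$ by a path of length $m$ through new vertices. The Robber Locating game on a graph $H$ is played between a cop (not on the graph) and a robber. The robber initially occupies any vertex of $H$, unknown to the cop. Each round consists of a move by the robber, in which he either moves to an adjacent vertex or stays where he is (there is no restriction on his moves; in particular he may move to the vertex probed in the previous round), followed by a probe by the cop: she chooses any vertex $p$ of $H$ and is told the graph distance in $H$ from $p$ to the robber's current location. The choice of probe may depend on the results of previous probes. The cop wins immediately if she can determine the robber's current location from the result of that probe together with the previous ones (i.e. exactly one current location is consistent with all results so far). A graph $H$ is locatable if the cop has a strategy which guarantees that she wins within a bounded number of rounds, whatever the robber does (equivalently, she can catch a robber who has full knowledge of her strategy). *)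

(* Defs.v *)
From mathcomp Require Import all_boot.

Set Implicit Arguments.
Unset Strict Implicit.
Unset Printing Implicit Defensive.

(* A finite simple graph is given by a symmetric irreflexive adjacency
   relation [e : rel V] on a finite type [V]. *)

Section Distance.
Variables (V : finType) (e : rel V).

Definition has_walk (x y : V) (n : nat) : bool :=
  [exists t : n.-tuple V, path e x t && (last x t == y)].

(* [find] returns the least length of a walk from [x] to [y]: a shortest walk
   repeats no vertex, so lengths below [#|V|] suffice.  The value is [#|V|]
   when there is no walk from [x] to [y]. *)
Definition gdist (x y : V) : nat := find (has_walk x y) (iota 0 #|V|).

Definition connected_graph : Prop := forall x y : V, connect e x y.

End Distance.

Section Subdivision.
Variables (V : finType) (e : rel V) (m : nat).

(* Exactly one of the two orientations of each edge, so that each edge is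
   subdivided once; which one is chosen is immaterial. *)
Definition oriented_edge : finType :=
  {p : V * V | e p.1 p.2 && (enum_rank p.1 < enum_rank p.2)}.

Definition subdiv_vertex : finType := (V + oriented_edge * 'I_m.-1)%type.

(* For [k <= m], the vertex at position [k] on the path of length [m] replacing
   the edge [a]: position [0] is the first end of [a], position [m] the second,
   and position [j.+1] with [j < m.-1] is the new vertex [inr (a, j)]. *)
Definition edge_path_vertex (a : oriented_edge) (k : nat) : subdiv_vertex :=
  if k is j.+1 then
    if insub j is Some i then inr (a, i) else inl (val a).2
  else inl (val a).1.

Definition subdiv_rel : rel subdiv_vertex := fun x y =>
  [exists a : oriented_edge, exists k : 'I_m,
     ((x == edge_path_vertex a k) && (y == edge_path_vertex a k.+1)) ||
     ((y == edge_path_vertex a k) && (x == edge_path_vertex a k.+1))].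

End Subdivision.

Arguments subdiv_rel {V} e m _ _.

Section Game.
Variables (V : finType) (e : rel V).

(* [r 0] is the robber's initial position and [r k] his position after his
   move in round [k >= 1], when the [k]-th probe is made. *)
Definition robber_walk (r : nat -> V) : Prop :=
  forall k, r k.+1 = r k \/ e (r k) (r k.+1).

(* A strategy gives the next probe from the list of previous results, oldest
   first; the previous probes are themselves determined by that list. *)
Definition strategy : Type := seq nat -> V.

Fixpoint results (s : strategy) (r : nat -> V) (k : nat) : seq nat :=
  if k is j.+1 then
    let h := results s r j in rcons h (gdist e (s h) (r j.+1))
  else [::].

Definition located (s : strategy) (r : nat -> V) (k : nat) : Prop :=
  forall r', robber_walk r' -> results s r' k = results s r k -> r' k = r k.

(* The bound [N] on the number of rounds is uniform in the robber's walk; a win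
   can only occur at a probe, hence [0 < k]. *)
Definition locatable : Prop :=
  exists (s : strategy) (N : nat), forall r, robber_walk r ->
    exists2 k, 0 < k <= N & located s r k.

End Game.

(* Main.v *)
Require Import Defs.
From mathcomp Require Import all_boot.
From mathcomp Require Import zify.

Set Implicit Arguments.
Unset Strict Implicit.
Unset Printing Implicit Defensive.

(** Original vertices are called branch vertices, and the path that replaces an
    edge is a thread.  A probe at a branch vertex [v] returns a multiple of [m] if
    and only if the robber is at a branch vertex, and less than [m] if and only if
    [v] is an end of his thread (or his position).  So the cop always learns when
    the robber is at a branch vertex, and it suffices to show that she wins whenever
    she knows a set [B] of branch vertices containing him.  This is
    [branches_winning], by induction on the size of [B]; initially, [off_winning]
    leads there.

    Suppose the robber leaves [B].  Probing the vertices of [B] in turn, the cop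
    finds an end of his thread ([departed_winning], [departed_large]).  If it is the
    end ahead of him, he has to turn back to a smaller subset of [B].  Otherwise it
    is the end [b] that he has left, and he needs [m] rounds in all to reach the
    other end, which is in some known set [C] of neighbours of [b].  Meanwhile the
    cop reduces [C].  A probe halfway along the thread from [b] to [c] eliminates
    [c] ([arms_probe]); a probe halfway along the thread between two adjacent
    vertices of [C] eliminates both ([span_pair]).  If [C] has a large enough
    matching, then, as there are at most [2 * m] vertices, fewer candidates are left
    at the other end than there were in [B] ([known_end_winning]).  The count leaves
    nothing to spare, so the first and the last rounds on the thread need probes of
    their own ([branches_pair], [arms1_pair], [arms_last_pair], [last_candidate]).

    If a maximum matching [M] of [C] leaves many vertices, these form an independent
    set [I], and the cop lets the robber reach it.  By maximality, the edges at [I]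
    are covered by one vertex per pair of [M] and the vertices outside [C], except
    for pairs that form a triangle with their only common neighbour in [I]
    ([unmatched_covered]).  This cover has fewer than [m] elements, so the cop can go
    through it while the robber walks along a thread from [I].  Once she knows the
    end ahead of him, he has to turn back.  Each such excursion reduces the set of
    candidates in [I], which wins ([covered_winning]).  These alternatives are
    balanced in [known_winning].

    Sets of positions for which the cop wins are the members of the inductive class
    [Win], from whose derivations a strategy is read off ([Win_locatable]).
    Distances in the subdivided graph come from [gdist_potential]. *)

(** * Distances in a finite graph *)

Section GraphDistance.
Variables (T : finType) (e : rel T).

Lemma has_walkP x y n :
  reflect (exists s : seq T, [/\ size s = n, path e x s & last x s = y])
          (has_walk e x y n).
Proof.
apply: (iffP existsP) => [[t /andP[pt /eqP lt]]|[s [sn ps ls]]].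
  by exists t; rewrite size_tuple.
have sn' : size s == n by apply/eqP.
by exists (Tuple sn') => /=; rewrite ps ls eqxx.
Qed.

Lemma has_walk_rcons x y z n :
  has_walk e x y n -> e y z -> has_walk e x z n.+1.
Proof.
move=> /has_walkP[s [sn ps ls]] eyz; apply/has_walkP; exists (rcons s z).
by rewrite size_rcons sn rcons_path ps ls eyz last_rcons.
Qed.

Lemma find_iota0 (p : pred nat) N k :
  k < N -> p k -> (forall i, p i -> k <= i) -> find p (iota 0 N) = k.
Proof.
move=> kN pk kmin.
have hp : has p (iota 0 N) by apply/hasP; exists k; rewrite ?mem_iota.
have fN : find p (iota 0 N) < N by move: (hp); rewrite has_find size_iota.
apply/eqP; rewrite eqn_leq; apply/andP; split; last first.
  by apply: kmin; move: (nth_find 0 hp); rewrite nth_iota.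
rewrite leqNgt; apply/negP => /(before_find 0).
by rewrite nth_iota // pk.
Qed.

Hypothesis e_conn : connected_graph e.

Lemma gdist_walk x y : has_walk e x y (gdist e x y).
Proof.
rewrite /gdist; set N := #|T|.
suff hp : has (has_walk e x y) (iota 0 N).
  have := nth_find 0 hp; rewrite nth_iota //.
  by move: hp; rewrite has_find size_iota.
have /connectP[s ps ->] := e_conn x y.
case/shortenP: ps => s' ps' us' _.
apply/hasP; exists (size s').
  by rewrite mem_iota /= add0n; have := max_card (mem (x :: s')); rewrite (card_uniqP us').
by apply/has_walkP; exists s'.
Qed.

Lemma gdist_min x y n : has_walk e x y n -> gdist e x y <= n.
Proof.
move=> wn; rewrite leqNgt; apply/negP => lt_n.
have := before_find 0 lt_n; rewrite nth_iota ?wn //.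
by apply: leq_trans lt_n _; rewrite -[X in _ <= X](size_iota 0); apply: find_size.
Qed.

Lemma gdistxx x : gdist e x x = 0.
Proof. by apply/eqP; rewrite -leqn0; apply: gdist_min; apply/has_walkP; exists [::]. Qed.

Lemma gdist_eq0 x y : gdist e x y = 0 -> x = y.
Proof. by move=> d0; have := gdist_walk x y; rewrite d0 => /has_walkP[[|a s] []]. Qed.

Lemma gdist_step x y z : e y z -> gdist e x z <= (gdist e x y).+1.
Proof. by move=> eyz; apply/gdist_min/(has_walk_rcons _ eyz)/gdist_walk. Qed.

Lemma gdist_pred x y :
  0 < gdist e x y -> exists2 z, e z y & gdist e x y = (gdist e x z).+1.
Proof.
case E: (gdist e x y) => [//|n] _.
have := gdist_walk x y; rewrite E => /has_walkP[s].
case/lastP: s => [[]//|s z [sn]].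
rewrite rcons_path last_rcons => /andP[ps ez] zy; subst z.
move: sn; rewrite size_rcons => -[sn].
exists (last x s) => //; congr S; apply/eqP; rewrite eqn_leq; apply/andP; split.
  by rewrite -ltnS -E; apply: gdist_step.
by apply/gdist_min/has_walkP; exists s.
Qed.

Lemma gdist_edge x y : x != y -> e x y -> gdist e x y = 1.
Proof.
move=> xy exy; have := gdist_step x exy; rewrite gdistxx.
case E: (gdist e x y) => [|[|//]] // _.
by case/eqP: xy; apply: gdist_eq0.
Qed.

Lemma gdist_eq1 x y : gdist e x y = 1 -> e x y.
Proof.
move=> d1; have [|z ezy] := gdist_pred (x := x) (y := y); rewrite d1 // => -[].
by move/esym/gdist_eq0 => ->.
Qed.

End GraphDistance.

Section Potential.
Variables (T : finType) (e : rel T) (x0 : T) (f : T -> nat).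
Hypothesis f0 : forall y, f y = 0 <-> y = x0.
Hypothesis f_step : forall x y, e x y -> f y <= (f x).+1.
Hypothesis f_pred : forall y, 0 < f y -> exists2 z, e z y & f y <= (f z).+1 /\ f z < f y.

(** A function that grows by at most one along each edge and that can be
    decreased along some edge everywhere except at [x0] is the distance from
    [x0]: this is how distances in a subdivided graph are computed. *)
Lemma gdist_potential y : gdist e x0 y = f y.
Proof.
have walk_ge n z : has_walk e x0 z n -> f z <= n.
  elim: n z => [|n IHn] z /has_walkP[s [sn ps ls]].
    by case: s sn ps ls => //= _ _ <-; rewrite (f0 _).2.
  case/lastP: s sn ps ls => // s z'.
  rewrite size_rcons rcons_path last_rcons => -[sn] /andP[ps ez] <-.
  apply: leq_trans (f_step ez) _; rewrite ltnS; apply: IHn.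
  by apply/has_walkP; exists s.
have walk_f n z : f z = n -> has_walk e x0 z n.
  elim: n z => [|n IHn] z fz.
    by apply/has_walkP; exists [::]; split=> //=; apply/esym/f0.
  have [|w ewz [le lt]] := f_pred (y := z); first by rewrite fz.
  by apply: has_walk_rcons ewz; apply: IHn; lia.
apply: find_iota0; [|exact: walk_f|by move=> i /walk_ge].
have below (k : 'I_(f y).+1) : exists z, f z = k.
  have [k' kk'] := ubnP (f y - k).
  elim: k' k kk' => // k' IH k kk'.
  have [ky|ky] := eqVneq (k : nat) (f y); first by exists y.
  have lt_k := ltn_ord k.
  have lt_k1 : k.+1 < (f y).+1 by lia.
  have [|z /= fz] := IH (Ordinal lt_k1); first by rewrite /=; lia.
  have [|w _ [le lt]] := f_pred (y := z); first by rewrite fz.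
  by exists w; lia.
have [g gf] := fin_all_exists below.
rewrite -[X in X <= _]card_ord; apply: (leq_card g) => k1 k2 eq_g.
by apply: val_inj; rewrite /= -(gf k1) -(gf k2) eq_g.
Qed.

End Potential.

(** * Winning sets of positions *)

Section WinningSets.
Variables (T : finType) (e : rel T).

Definition after (P : T -> Prop) (p : T) (d : nat) (y : T) : Prop :=
  gdist e p y = d /\ exists2 x, P x & y = x \/ e x y.

(** [P] stands for the set of the positions that are consistent with the past
    results.  Each branch of a derivation is finite and probes have finitely many
    results, so that a derivation bounds the number of rounds. *)
Inductive Win : (T -> Prop) -> Prop :=
| Win_one P x of (forall y, P y -> y = x) : Win P
| Win_probe P p of (forall d, Win (after P p d)) : Win P.

Lemma Win_sub P Q : Win Q -> (forall y, P y -> Q y) -> Win P.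
Proof.
move=> winQ; elim: winQ P => [{}Q x one|{}Q p _ IH] P PQ.
  by apply: (@Win_one _ x) => y /PQ /one.
apply: (@Win_probe _ p) => d; apply: (IH d) => y [dy [x /PQ Qx xy]].
by split=> //; exists x.
Qed.

Definition wins_within (P : T -> Prop) (s : strategy T) (lo N : nat) : Prop :=
  forall w, robber_walk e w -> P (w 0) -> exists2 k, lo <= k <= N &
    forall w', robber_walk e w' -> P (w' 0) ->
      results e s w' k = results e s w k -> w' k = w k.

Lemma gdist_bound x y : gdist e x y < (#|T|).+1.
Proof. by rewrite ltnS /gdist -[X in _ <= X](size_iota 0) find_size. Qed.

(** Strategies for all the results of a first probe are glued together:
    the head of the list of results selects the one to follow. *)
Lemma probe_strategy P p :
  (forall d, exists s N, wins_within (after P p d) s 0 N) ->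
  exists s N, wins_within P s 1 N.
Proof.
move=> wins.
have [f fP] : exists f : 'I_(#|T|).+1 -> strategy T * nat,
    forall d : 'I_(#|T|).+1, wins_within (after P p d) (f d).1 0 (f d).2.
  apply: (@fin_all_exists 'I_(#|T|).+1 (fun=> (strategy T * nat)%type)
    (fun d sN => wins_within (after P p d) sN.1 0 sN.2)) => d.
  by have [s [N sN]] := wins d; exists (s, N).
pose s h := if h is d :: h' then (f (inord d)).1 h' else p.
pose shift (w : nat -> T) k := w k.+1.
have resS w k : results e s w k.+1 =
    let d := gdist e p (w 1) in d :: results e (f (inord d)).1 (shift w) k.
  elim: k => [//|k IHk].
  by rewrite [LHS]/= -/(results e s w k.+1) IHk /=.
exists s, (\max_(d < (#|T|).+1) (f d).2).+1 => w walk_w Pw0.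
pose d := inord (gdist e p (w 1)) : 'I_(#|T|).+1.
have dE : d = gdist e p (w 1) :> nat by rewrite inordK // gdist_bound.
have start w' : robber_walk e w' -> P (w' 0) -> gdist e p (w' 1) = d ->
    after P p d (shift w' 0).
  by move=> walk_w' Pw' E; split=> //; exists (w' 0) => //; apply: walk_w'.
have walkS w' : robber_walk e w' -> robber_walk e (shift w').
  by move=> walk_w' k; apply: walk_w'.
have [k /andP[_ kN] win_k] := fP d (shift w) (walkS _ walk_w) (start _ walk_w Pw0 (esym dE)).
exists k.+1.
  rewrite ltn0Sn /= ltnS; apply: leq_trans kN _.
  exact: (@leq_bigmax _ (fun d => (f d).2) d).
move=> w' walk_w' Pw'; rewrite !resS /= => -[E1 E2].
apply: (win_k (shift w')) => //; first exact: walkS.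
  by apply: start; rewrite // E1.
by move: E2; rewrite E1.
Qed.

Lemma Win_strategy P : Win P -> exists s N, wins_within P s 0 N.
Proof.
elim=> [{}P x one|{}P p _ /probe_strategy[s [N sN]]].
  exists (fun=> x), 0 => w _ /one E; exists 0 => // w' _ /one E' _.
  by rewrite E E'.
exists s, N => w walk_w Pw; have [k /andP[_ kN] win_k] := sN w walk_w Pw.
by exists k.
Qed.

Lemma Win_locatable : 1 < #|T| -> Win (fun=> True) -> locatable e.
Proof.
move=> T_gt1 win.
(* There are several positions, so the game is not won before the first probe. *)
have start P : Win P -> (forall y, P y) -> exists s N, wins_within P s 1 N.
  case=> [{}P x one|{}P p winP] PT.
    suff : #|T| <= 1 by rewrite leqNgt T_gt1.
    by apply/card_le1_eqP => y z _ _; exact: (etrans (one z (PT z)) (esym (one y (PT y)))).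
  by apply: probe_strategy => d; apply: Win_strategy.
have [s [N sN]] := start _ win (fun=> I).
exists s, N => w walk_w; have [k kN win_k] := sN w walk_w I.
by exists k => // w' walk_w'; apply: win_k.
Qed.

End WinningSets.

Section Subdivided.
Variables (V : finType) (e : rel V) (m : nat).
Hypotheses (e_sym : symmetric e) (e_irr : irreflexive e).
Hypotheses (e_conn : connected_graph e) (m_ge12 : 12 <= m).
Hypotheses (n_le2m : #|V| <= 2 * m) (V_gt1 : 1 < #|V|).


(* Boolean facts about sets and edges make [lia] split cases needlessly. *)
Ltac nlia := repeat match goal with
  | H : is_true (in_mem _ _) |- _ => clear H
  | H : is_true (negb (in_mem _ _)) |- _ => clear H
  | H : is_true (e _ _) |- _ => clear H
  | H : is_true (@eq_op _ ?x _) |- _ =>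
      lazymatch type of x with nat => fail | _ => clear H end
  | H : is_true (negb (@eq_op _ ?x _)) |- _ =>
      lazymatch type of x with nat => fail | _ => clear H end
  | H : is_true (uniq _) |- _ => clear H
  | H : is_true (all _ _) |- _ => clear H
  | H : is_true (negb (FiniteQuant.quant0b _)) |- _ => clear H
  | H : @eq ?T ?x ?y |- _ =>
      lazymatch T with nat => fail | _ =>
        tryif unify T nat then change (@eq nat x y) in H else clear H
      end
  end; lia.

(** * Points of a subdivided graph and their distances *)

Lemma m_gt1 : 1 < m.
Proof. exact: leq_trans m_ge12. Qed.
Hint Resolve m_gt1 : core.

Local Notation point := (subdiv_vertex e m).
Local Notation epv := (edge_path_vertex m).

(** The point at distance [p] from [b] on the thread between the ends of an edge,
    that is, on the path replacing it.  The coordinates are independent of the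
    orientation of the edge: this is [pt_sym] below. *)
Definition pt (b c : V) (p : nat) : point :=
  if insub (b, c) is Some a then epv a p
  else if insub (c, b) is Some a then epv a (m - p) else inl b.

Lemma edge_neq b c : e b c -> b != c.
Proof. by apply: contraTneq => ->; rewrite e_irr. Qed.

Lemma epv_end (a : oriented_edge e) : epv a m = inl (val a).2.
Proof.
have end_k k : k = m -> epv a k = inl (val a).2.
  by case: k => [|k] km /=; [lia|rewrite insubF //; lia].
exact: end_k.
Qed.

Lemma epv_inner (a : oriented_edge e) k :
  0 < k < m -> exists2 i : 'I_m.-1, k = i.+1 & epv a k = inr (a, i).
Proof.
case: k => //= j jm; have jm' : j < m.-1 by lia.
by exists (Ordinal jm') => //; rewrite (insubT (fun i => i < m.-1) jm').
Qed.

Lemma epv_inr (a : oriented_edge e) (i : 'I_m.-1) : epv a i.+1 = inr (a, i).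
Proof. by rewrite /= valK. Qed.

Lemma oriented_edge_e (a : oriented_edge e) : e (val a).1 (val a).2.
Proof. by case/andP: (valP a). Qed.

Lemma pt_oriented (a : oriented_edge e) k : pt (val a).1 (val a).2 k = epv a k.
Proof. by rewrite /pt -surjective_pairing valK. Qed.

Lemma pt_cases b c : e b c -> exists a : oriented_edge e,
  (val a = (b, c) /\ (forall p, pt b c p = epv a p) /\ (forall p, pt c b p = epv a (m - p)))
  \/ (val a = (c, b) /\ (forall p, pt b c p = epv a (m - p)) /\ (forall p, pt c b p = epv a p)).
Proof.
move=> ebc; have ecb : e c b by rewrite e_sym.
have nbc := edge_neq ebc.
case: (ltngtP (enum_rank b) (enum_rank c)) => [lt|lt|eq].
- have P : e (b, c).1 (b, c).2 && (enum_rank (b, c).1 < enum_rank (b, c).2).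
    by rewrite /= ebc.
  exists (Sub (b, c) P); left; rewrite SubK; do !split=> //; move=> p; rewrite /pt.
    by rewrite (insubT (fun q : V * V => e q.1 q.2 && (enum_rank q.1 < enum_rank q.2)) P).
  rewrite insubF /=; last by rewrite ecb ltnNge ltnW.
  by rewrite (insubT (fun q : V * V => e q.1 q.2 && (enum_rank q.1 < enum_rank q.2)) P).
- have P : e (c, b).1 (c, b).2 && (enum_rank (c, b).1 < enum_rank (c, b).2).
    by rewrite /= ecb.
  exists (Sub (c, b) P); right; rewrite SubK; do !split=> //; move=> p; rewrite /pt.
    rewrite insubF /=; last by rewrite ebc ltnNge ltnW.
    by rewrite (insubT (fun q : V * V => e q.1 q.2 && (enum_rank q.1 < enum_rank q.2)) P).
  by rewrite (insubT (fun q : V * V => e q.1 q.2 && (enum_rank q.1 < enum_rank q.2)) P).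
by case/eqP: nbc; apply: enum_rank_inj; apply: val_inj.
Qed.

Lemma pt_sym b c p : e b c -> p <= m -> pt b c p = pt c b (m - p).
Proof.
move=> ebc pm; have [a [[_ [-> ->]]|[_ [-> ->]]]] := pt_cases ebc => //.
by rewrite subKn.
Qed.

Lemma pt0 b c : e b c -> pt b c 0 = inl b.
Proof.
move=> ebc; have [a [[va [-> _]]|[va [-> _]]]] := pt_cases ebc.
  by rewrite /= va.
by rewrite subn0 epv_end va.
Qed.

Lemma ptm b c : e b c -> pt b c m = inl c.
Proof. by move=> ebc; rewrite pt_sym // subnn pt0 // e_sym. Qed.

Lemma pt_surj (y : point) :
  (exists b, y = inl b) \/ exists b c p, [/\ e b c, 0 < p < m & y = pt b c p].
Proof.
case: y => [b|[a i]]; [by left; exists b|right].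
exists (val a).1, (val a).2, i.+1; split; first exact: oriented_edge_e.
  by have := ltn_ord i; lia.
by rewrite pt_oriented epv_inr.
Qed.

Lemma subdiv_rel_sym : symmetric (subdiv_rel e m).
Proof.
by move=> x y; apply/eq_existsb => a; apply/eq_existsb => k; rewrite orbC.
Qed.

Lemma epv_adj (a : oriented_edge e) k : k < m -> subdiv_rel e m (epv a k) (epv a k.+1).
Proof.
move=> km; apply/existsP; exists a; apply/existsP; exists (Ordinal km).
by rewrite !eqxx.
Qed.

Lemma pt_adj b c p : e b c -> p < m -> subdiv_rel e m (pt b c p) (pt b c p.+1).
Proof.
move=> ebc pm; have [a [[_ [E _]]|[_ [E _]]]] := pt_cases ebc; rewrite !E; first exact: epv_adj.
rewrite subdiv_rel_sym; have -> : m - p = (m - p.+1).+1 by lia.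
by apply: epv_adj; lia.
Qed.

Lemma subdiv_relP x y : subdiv_rel e m x y ->
  exists (a : oriented_edge e) k, k < m /\
   ((x = epv a k /\ y = epv a k.+1) \/ (y = epv a k /\ x = epv a k.+1)).
Proof.
case/existsP=> a /existsP[k] /orP[] /andP[/eqP-> /eqP->]; exists a, k; split=> //.
  by left.
by right.
Qed.

Lemma epv_inner_inj (a a' : oriented_edge e) k k' :
  0 < k < m -> k' <= m -> epv a k = epv a' k' -> a = a' /\ k = k'.
Proof.
move=> km k'm; have [i -> ->] := epv_inner a km.
have [k'0|k'0] := boolP (0 < k' < m).
  by have [i' -> ->] := epv_inner a' k'0 => -[-> ->].
have [->//|k'n0] := eqVneq k' 0; have -> : k' = m by lia.
by rewrite epv_end.
Qed.

Lemma pt_inner_move b c p y : e b c -> 0 < p < m -> subdiv_rel e m (pt b c p) y ->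
  y = pt b c p.-1 \/ y = pt b c p.+1.
Proof.
move=> ebc pm /subdiv_relP[a' [k [km xy]]].
have [a [[_ [E _]]|[_ [E _]]]] := pt_cases ebc; rewrite !E in xy *.
  case: xy => [[/epv_inner_inj [//||<- <-]]|[-> /epv_inner_inj [//||<- ->]]] => //.
  - exact: ltnW.
  - by right.
  - by left.
case: xy => [[]|[->]] /epv_inner_inj; (case; [lia|lia|]) => <- kE.
  by move=> ->; left; congr edge_path_vertex; lia.
by right; congr edge_path_vertex; lia.
Qed.

Lemma inl_move b y : subdiv_rel e m (inl b) y -> exists2 c, e b c & y = pt b c 1.
Proof.
case/subdiv_relP=> a [k [km xy]].
have ea := oriented_edge_e a; have ea' : e (val a).2 (val a).1 by rewrite e_sym.
case: xy => [[bE ->]|[-> bE]].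
  case: k km bE => [|k] km bE; last first.
    by have [|i _ E] := @epv_inner a k.+1; [lia|rewrite E in bE].
  by case: bE => ->; exists (val a).2; rewrite // pt_oriented.
have [k1|k1] := ltnP k.+1 m.
  by have [|i _ E] := @epv_inner a k.+1; [lia|rewrite E in bE].
have km' : k.+1 = m by lia.
rewrite km' epv_end in bE; case: bE => ->; exists (val a).1 => //.
by rewrite (pt_sym ea' _) ?pt_oriented; [congr edge_path_vertex; lia|lia].
Qed.

(** ** Distances *)

Definition mdist x y := m * gdist e x y.

Lemma mdistxx x : mdist x x = 0.
Proof. by rewrite /mdist gdistxx ?muln0. Qed.

Lemma mdist_edge x y : e x y -> mdist x y = m.
Proof. by move=> exy; rewrite /mdist gdist_edge ?muln1 ?edge_neq. Qed.

Lemma mdist_step x b c : e b c -> mdist x c <= mdist x b + m.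
Proof. by move=> ebc; have := gdist_step e_conn x ebc; rewrite /mdist; nia. Qed.

Lemma mdist_far x y : x != y -> ~~ e x y -> 2 * m <= mdist x y.
Proof.
move=> xy nexy; rewrite /mdist mulnC leq_mul2l; apply/orP; right.
case D: (gdist e x y) => [|[|//]].
  by have := gdist_eq0 e_conn D; move/eqP: xy.
by rewrite (gdist_eq1 e_conn D) in nexy.
Qed.

Lemma mdist_ge x y : x != y -> m <= mdist x y.
Proof.
move=> xy; have [exy|nexy] := boolP (e x y); first by rewrite mdist_edge.
by have := mdist_far xy nexy; lia.
Qed.

Lemma mdist_cases x y : [\/ x = y /\ mdist x y = 0,
   [/\ x != y, e x y & mdist x y = m] | [/\ x != y, ~~ e x y & 2 * m <= mdist x y]].
Proof.
have [<-|xy] := eqVneq x y; first by constructor 1; rewrite mdistxx.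
have [exy|nexy] := boolP (e x y).
  by constructor 2; rewrite mdist_edge.
by constructor 3; rewrite mdist_far.
Qed.

Lemma mdist_pred x y : 0 < mdist x y ->
  exists2 z, e z y & mdist x y = mdist x z + m.
Proof.
rewrite {1}/mdist muln_gt0 => /andP[_ /(gdist_pred e_conn)[z ezy E]].
by exists z; rewrite // /mdist E mulnS addnC.
Qed.

Definition branch_dist u v j w := minn (j + mdist u w) (m - j + mdist v w).

Definition nat_dist p q := (p - q) + (q - p).

(** A path from a point on the thread [u v] leaves this thread through [u] or
    through [v], and a path to a point on another thread arrives through one of
    its ends; inside the thread [u v] the distance is that of the line. *)
Section Source.
Variables (a0 : oriented_edge e) (j0 : nat).
Hypothesis j0m : j0 <= m.
Let u := (val a0).1.
Let v := (val a0).2.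
Let dd := branch_dist u v j0.

Definition dist_from (y : point) : nat :=
  match y with
  | inl w => dd w
  | inr (a, i) => if a == a0 then nat_dist i.+1 j0
                  else minn (dd (val a).1 + i.+1) (dd (val a).2 + (m - i.+1))
  end.

Let euv : e u v. Proof. exact: oriented_edge_e. Qed.

Lemma branch_dist_step b c : e b c -> dd c <= dd b + m.
Proof.
by move=> ebc; have := mdist_step u ebc; have := mdist_step v ebc; rewrite /dd/branch_dist; lia.
Qed.

Lemma branch_dist_u : dd u = j0.
Proof. by rewrite /dd/branch_dist mdistxx mdist_edge 1?e_sym //; lia. Qed.

Lemma branch_dist_v : dd v = m - j0.
Proof. by rewrite /dd/branch_dist mdistxx mdist_edge //; lia. Qed.

Lemma dist_from_epv a k : k <= m -> dist_from (epv a k) =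
  if a == a0 then nat_dist k j0 else minn (dd (val a).1 + k) (dd (val a).2 + (m - k)).
Proof.
move=> km; have ea := oriented_edge_e a.
have st1 := branch_dist_step ea; rewrite e_sym in ea; have st2 := branch_dist_step ea.
have [k0|k0] := boolP (0 < k < m).
  by have [i -> ->] := epv_inner a k0.
have [->|kn0] := eqVneq k 0.
  have -> : dist_from (epv a 0) = dd (val a).1 by [].
  by case: eqP => [->|_]; rewrite ?branch_dist_u /nat_dist; lia.
have -> : k = m by lia.
rewrite epv_end; have -> : dist_from (inl (val a).2) = dd (val a).2 by [].
by case: eqP => [->|_]; rewrite ?branch_dist_v /nat_dist; lia.
Qed.

Lemma dist_from0 y : dist_from y = 0 <-> y = epv a0 j0.
Proof.
split=> [|->]; last by rewrite dist_from_epv // eqxx /nat_dist; lia.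
case: y => [w|[a i]] /=.
  move=> d0; have : (j0 = 0 /\ mdist u w = 0) \/ (j0 = m /\ mdist v w = 0).
    by move: d0; rewrite /dd/branch_dist; lia.
  case=> -[-> /eqP]; rewrite /mdist muln_eq0 => /orP[/eqP|/eqP/(gdist_eq0 e_conn) <-].
  - by lia.
  - by [].
  - by lia.
  - by rewrite epv_end.
have im := ltn_ord i; case: eqP => [->|_]; last by lia.
rewrite -epv_inr => d0; congr edge_path_vertex; move: d0; rewrite /nat_dist; lia.
Qed.

Lemma dist_from_step x y : subdiv_rel e m x y -> dist_from y <= (dist_from x).+1.
Proof.
case/subdiv_relP=> a [k [km xy]].
have E1 := @dist_from_epv a k (ltnW km); have E2 := @dist_from_epv a k.+1 km.
by case: xy => [[-> ->]|[-> ->]]; rewrite E1 E2; case: eqP => _; rewrite /nat_dist; lia.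
Qed.

Lemma dist_from_pt b c p : e b c -> p <= m -> dist_from (pt b c p) =
  if (b == u) && (c == v) then nat_dist p j0 else
  if (b == v) && (c == u) then nat_dist (m - p) j0 else
  minn (dd b + p) (dd c + (m - p)).
Proof.
move=> ebc pm; have nuv := edge_neq euv.
have nbc := edge_neq ebc.
have [a [[va [-> _]]|[va [-> _]]]] := pt_cases ebc.
  rewrite dist_from_epv // va /= -val_eqE /= va {1}[val a0]surjective_pairing.
  rewrite xpair_eqE -/u -/v; case: ifP => // buv.
  case: ifP => // /andP[/eqP bv /eqP cu].
  have : enum_rank b < enum_rank c by have := valP a; rewrite va => /andP[].
  have := valP a0; rewrite -/u -/v => /andP[_]; rewrite bv cu; lia.
rewrite dist_from_epv ?leq_subr // va /= -val_eqE /= va {1}[val a0]surjective_pairing.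
rewrite xpair_eqE -/u -/v [(c == u) && _]andbC subKn //.
case: (boolP ((b == u) && (c == v))) => [/andP[/eqP bu /eqP cv]|_].
  have : enum_rank c < enum_rank b by have := valP a; rewrite va => /andP[].
  have := valP a0; rewrite -/u -/v => /andP[_]; rewrite bu cv; lia.
by case: ifP => // _; rewrite minnC.
Qed.

Lemma dist_from_pred y : 0 < dist_from y -> exists2 z, subdiv_rel e m z y &
  dist_from y <= (dist_from z).+1 /\ dist_from z < dist_from y.
Proof.
move=> y_gt0.
suff [z zy lt] : exists2 z, subdiv_rel e m z y & dist_from z < dist_from y.
  by exists z => //; split=> //; apply: dist_from_step.
have nuv := edge_neq euv; have evu : e v u by rewrite e_sym.
case: y y_gt0 => [w|[a i]].
  move=> /= w_gt0.
  have nb z : e z w -> subdiv_rel e m (pt w z 1) (inl w).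
    move=> ezw; have ewz : e w z by rewrite e_sym.
    by rewrite -(pt0 ewz) subdiv_rel_sym pt_adj //; lia.
  have [side|side] := leqP (j0 + mdist u w) (m - j0 + mdist v w).
    have ddw : dd w = j0 + mdist u w by rewrite /dd/branch_dist; lia.
    have [uw|uw] := posnP (mdist u w).
      have uw' : u = w by case: (mdist_cases u w) => [[]//|[_ _]|[_ _]]; lia.
      exists (pt u v 1); first by rewrite -uw' -(pt0 euv) subdiv_rel_sym pt_adj //; lia.
      rewrite dist_from_pt ?eqxx //=; last lia.
      by rewrite /nat_dist; move: w_gt0; rewrite ddw uw; lia.
    have [z ezw E] := mdist_pred uw; have ewz : e w z by rewrite e_sym.
    exists (pt w z 1); first exact: nb.
    rewrite dist_from_pt //; last lia.
    have ddz : dd z <= j0 + mdist u z by rewrite /dd/branch_dist; lia.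
    case: ifP => [/andP[/eqP wu _]|_]; first by rewrite wu mdistxx in uw.
    case: ifP => [/andP[/eqP wv /eqP zu]|_]; last by lia.
    rewrite wv branch_dist_v /nat_dist; move: side; rewrite wv mdistxx mdist_edge //; lia.
  have ddw : dd w = m - j0 + mdist v w by rewrite /dd/branch_dist; lia.
  have [vw|vw] := posnP (mdist v w).
    have wv : v = w by case: (mdist_cases v w) => [[]//|[_ _]|[_ _]]; lia.
    exists (pt w u 1); first by apply: nb; rewrite -wv.
    have nvu : (v == u) = false by rewrite eq_sym (negPf nuv).
    move: w_gt0; rewrite ddw vw -wv => w_gt0; rewrite dist_from_pt //; last lia.
    by rewrite nvu !eqxx /nat_dist /=; lia.
  have [z ezw E] := mdist_pred vw; have ewz : e w z by rewrite e_sym.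
  exists (pt w z 1); first exact: nb.
  rewrite dist_from_pt //; last lia.
  have ddz : dd z <= m - j0 + mdist v z by rewrite /dd/branch_dist; lia.
  case: ifP => [/andP[/eqP wu /eqP zv]|_]; last first.
    by case: ifP => [/andP[/eqP wv _]|_]; [rewrite wv mdistxx in vw|lia].
  rewrite wu branch_dist_u /nat_dist; move: side; rewrite wu mdistxx mdist_edge //; lia.
have im := ltn_ord i.
rewrite -!epv_inr dist_from_epv; last lia.
have adj1 : subdiv_rel e m (epv a i) (epv a i.+1) by apply: epv_adj; lia.
have adj2 : subdiv_rel e m (epv a i.+2) (epv a i.+1).
  by rewrite subdiv_rel_sym epv_adj //; lia.
have E1 := @dist_from_epv a i; have E2 := @dist_from_epv a i.+2.
case: eqP E1 E2 => [_|_] E1 E2 gt0.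
  have [ji|ji] := leqP i.+1 j0.
    by exists (epv a i.+2); rewrite // E2 ?/nat_dist; move: gt0; rewrite /nat_dist; lia.
  by exists (epv a i); rewrite // E1 ?/nat_dist; move: gt0; rewrite /nat_dist; lia.
have [ab|ab] := leqP (dd (val a).1 + i.+1) (dd (val a).2 + (m - i.+1)).
  by exists (epv a i); rewrite // E1; lia.
by exists (epv a i.+2); rewrite // E2; lia.
Qed.

End Source.

Lemma gdist_pt u v j b c p : e u v -> j <= m -> e b c -> p <= m ->
  gdist (subdiv_rel e m) (pt u v j) (pt b c p) =
  if (b == u) && (c == v) then nat_dist p j else
  if (b == v) && (c == u) then nat_dist (m - p) j else
  minn (branch_dist u v j b + p) (branch_dist u v j c + (m - p)).
Proof.
move=> euv jm ebc pm.
have main (a : oriented_edge e) k y : k <= m ->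
    gdist (subdiv_rel e m) (epv a k) y = dist_from a k y.
  move=> km; apply: gdist_potential.
  - exact: dist_from0.
  - exact: dist_from_step.
  - exact: dist_from_pred.
have [a [[va [-> _]]|[va [-> _]]]] := pt_cases euv.
  by rewrite main // dist_from_pt // va.
rewrite main ?leq_subr // dist_from_pt ?leq_subr // va /=.
have nuv := edge_neq euv.
have nvu : (v == u) = false by rewrite eq_sym (negPf nuv).
case: (boolP ((b == v) && (c == u))) => [/andP[/eqP-> /eqP->]|_].
  by rewrite nvu ?eqxx /nat_dist /=; lia.
by case: ifP => _; rewrite /nat_dist /branch_dist; lia.
Qed.

(** * Probes in a subdivided graph *)

Notation winning := (Win (subdiv_rel e m)).

(** So the coordinates of points also cover the branch vertices. *)
Lemma has_nbr b : exists c, e b c.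
Proof.
have [c cb] : exists c, c != b.
  apply/existsP; rewrite -negb_forall; apply: contraTN V_gt1 => /forallP all_b.
  rewrite -leqNgt; apply/card_le1_eqP => x y _ _.
  by have /eqP-> := all_b x; have /eqP-> := all_b y.
have /connectP[[|d s] /=] := e_conn b c; first by move=> _ E; rewrite E eqxx in cb.
by case/andP=> ebd _ _; exists d.
Qed.

Lemma mdist_step_l v w b : e v w -> mdist v b <= m + mdist w b.
Proof.
move=> evw; rewrite /mdist -mulnS leq_mul2l; apply/orP; right.
have /has_walkP[s [ss ps ls]] := gdist_walk e_conn w b.
by apply/(gdist_min (x := v))/has_walkP; exists (w :: s); rewrite /= ss ps evw.
Qed.

(** A point inside a thread has two triples of coordinates and a branch vertex
    has many: a point is in this set as soon as one triple satisfies [S], so that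
    [S] may impose a direction on the thread. *)
Definition points (S : V -> V -> nat -> Prop) (y : subdiv_vertex e m) : Prop :=
  exists b c p, [/\ e b c, p <= m, S b c p & y = pt b c p].

Definition branches (B : {set V}) (y : subdiv_vertex e m) : Prop := exists2 b, b \in B & y = inl b.

Definition thread_dist u v j b c p : nat :=
  if (b == u) && (c == v) then nat_dist p j else
  if (b == v) && (c == u) then nat_dist (m - p) j else
  minn (branch_dist u v j b + p) (branch_dist u v j c + (m - p)).

Definition end_dist v b c p : nat := minn (mdist v b + p) (mdist v c + (m - p)).

Lemma thread_dist0 v w b c p : e v w -> e b c -> p <= m ->
  thread_dist v w 0 b c p = end_dist v b c p.
Proof.
move=> evw ebc pm; have ewv : e w v by rewrite e_sym.
have l x := mdist_step_l x evw.
rewrite /thread_dist /end_dist /branch_dist.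
case: ifP => [/andP[/eqP-> /eqP->]|_].
  by rewrite mdistxx mdist_edge // /nat_dist; lia.
case: ifP => [/andP[/eqP-> /eqP->]|_].
  by rewrite mdistxx mdist_edge // /nat_dist; lia.
by have := l b; have := l c; lia.
Qed.

Lemma points_sub S S' : winning (points S') ->
  (forall b c p, e b c -> p <= m -> S b c p -> S' b c p) -> winning (points S).
Proof.
move=> win sub; apply: Win_sub win _ => y [b [c [p [ebc pm Sp yE]]]].
by exists b, c, p; split=> //; apply: sub.
Qed.

Lemma points_one S (x : subdiv_vertex e m) :
  (forall b c p, e b c -> p <= m -> S b c p -> pt b c p = x) -> winning (points S).
Proof. by move=> one; apply: (@Win_one _ _ _ x) => y [b [c [p [ebc pm Sp ->]]]]; apply: one. Qed.

Lemma points_void S : (forall b c p, e b c -> p <= m -> S b c p -> False) -> winning (points S).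
Proof.
move=> void; have /ltnW/card_gt0P[b _] := V_gt1.
by apply: (@points_one _ (inl b)) => b' c p ebc pm /void; case.
Qed.

Lemma points_branches S (B : {set V}) : winning (branches B) ->
  (forall b c p, e b c -> S b c p -> (p = 0 /\ b \in B) \/ (p = m /\ c \in B)) ->
  winning (points S).
Proof.
move=> win sub; apply: Win_sub win _ => y [b [c [p [ebc pm Sp ->]]]].
case: (sub b c p ebc Sp) => [[-> bB]|[-> cB]].
  by exists b => //; rewrite pt0.
by exists c => //; rewrite ptm.
Qed.

Lemma branches_sub (B B' : {set V}) : winning (branches B') -> B \subset B' -> winning (branches B).
Proof.
move=> win /subsetP BB'; apply: Win_sub win _ => y [b bB ->].
by exists b; rewrite ?BB'.
Qed.

Lemma branches_one (B : {set V}) : #|B| <= 1 -> winning (branches B).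
Proof.
have /ltnW/card_gt0P[b0 _] := V_gt1.
move=> /card_le1_eqP B1; have [->|[b bB]] := set_0Vmem B.
  by apply: (@Win_one _ _ _ (inl b0)) => y [b]; rewrite inE.
by apply: (@Win_one _ _ _ (inl b)) => y [b' b'B ->]; rewrite (B1 b b').
Qed.

Definition moved (S : V -> V -> nat -> Prop) b c p' : Prop :=
  exists p, [/\ S b c p, p <= p'.+1 & p' <= p.+1].

Lemma probe_point u v j S : e u v -> j <= m ->
  (forall b c p, S b c p -> 0 < p < m) ->
  (forall d, winning (points (fun b c p => moved S b c p /\ thread_dist u v j b c p = d))) ->
  winning (points S).
Proof.
move=> euv jm inner win; apply: (@Win_probe _ _ _ (pt u v j)) => d.
apply: Win_sub (win d) _ => y [dy [x [b [c [p [ebc pm Sp xE]]] mv]]].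
have p_in := inner _ _ _ Sp.
have [p' [pp' p'p p'm yE]] : exists p', [/\ p <= p'.+1, p' <= p.+1, p' <= m & y = pt b c p'].
  case: mv => [->|]; first by exists p; split; rewrite ?xE //; lia.
  rewrite xE => /pt_inner_move; case=> //.
    by move=> ->; exists p.-1; split=> //; lia.
  by move=> ->; exists p.+1; split=> //; lia.
exists b, c, p'; split=> //; split; first by exists p.
by rewrite -dy yE gdist_pt.
Qed.

Lemma probe_branches u v j (B : {set V}) : e u v -> j <= m ->
  (forall d, winning (points (fun b c p =>
    [/\ b \in B, p <= 1 & thread_dist u v j b c p = d]))) ->
  winning (branches B).
Proof.
move=> euv jm win; apply: (@Win_probe _ _ _ (pt u v j)) => d.
apply: Win_sub (win d) _ => y [dy [x [b bB xE] mv]].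
have [c [p' [ebc p'1 yE]]] : exists c p', [/\ e b c, p' <= 1 & y = pt b c p'].
  case: mv => [->|].
    by have [c ebc] := has_nbr b; exists c, 0; rewrite xE pt0.
  by rewrite xE => /inl_move[] // c ebc ->; exists c, 1.
exists b, c, p'; split=> //; first lia.
by split=> //; rewrite -dy yE gdist_pt //; lia.
Qed.

Lemma probe_end v S : (forall b c p, S b c p -> 0 < p < m) ->
  (forall d, winning (points (fun b c p => moved S b c p /\ end_dist v b c p = d))) ->
  winning (points S).
Proof.
move=> inner win; have [w evw] := has_nbr v.
apply: (probe_point evw (leq0n _) inner) => d; apply: points_sub (win d) _.
by move=> b c p ebc pm [mv dE]; split=> //; rewrite -dE thread_dist0.
Qed.

Lemma probe_end_branches v (B : {set V}) :
  (forall d, winning (points (fun b c p =>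
    [/\ b \in B, p <= 1 & end_dist v b c p = d]))) ->
  winning (branches B).
Proof.
move=> win; have [w evw] := has_nbr v.
apply: (probe_branches evw (leq0n _)) => d; apply: points_sub (win d) _.
by move=> b c p ebc pm [bB p1 dE]; split=> //; rewrite -dE thread_dist0.
Qed.

(** ** Results of the probes that are used *)

Lemma end_dist_left v c p : e v c -> p <= m -> end_dist v v c p = p.
Proof. by move=> evc pm; rewrite /end_dist mdistxx mdist_edge //; lia. Qed.

Lemma end_dist_right v b p : e b v -> p <= m -> end_dist v b v p = m - p.
Proof. by move=> ebv pm; rewrite /end_dist mdistxx mdist_edge 1?e_sym //; lia. Qed.

Lemma end_dist_other v b c p : e b c -> v != b -> v != c -> p <= m ->
  m + minn p (m - p) <= end_dist v b c p.
Proof.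
move=> ebc vb vc pm; have := mdist_ge vb.
by have := mdist_ge vc; rewrite /end_dist; lia.
Qed.

(** As branch vertices are at multiples of [m] from one another, a probe at a
    branch vertex tells the distance of the robber to the nearest branch vertex. *)
Lemma end_dist_mod v b c p : p <= m ->
  end_dist v b c p %% m = p %% m \/ end_dist v b c p %% m = (m - p) %% m.
Proof.
move=> pm; rewrite /end_dist /mdist.
case: (leqP (m * gdist e v b + p) (m * gdist e v c + (m - p))) => _.
  by left; rewrite mulnC modnMDl.
by right; rewrite mulnC modnMDl.
Qed.

(** The shortest path to a point on another thread at [b] always goes through
    [b], as the first half of the thread to [c0] is not longer than the second. *)
Lemma thread_dist_star b c0 h c p : 2 * h <= m -> e b c0 -> e b c -> p <= m ->
  thread_dist b c0 h b c p = if c == c0 then nat_dist p h else h + p.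
Proof.
move=> hm eb0 ebc pm; have e0b : e c0 b by rewrite e_sym.
rewrite /thread_dist eqxx /=.
case: eqP => [//|/eqP c_c0]; rewrite (negPf (edge_neq eb0)) /=.
rewrite /branch_dist mdistxx (mdist_edge ebc) (mdist_edge e0b).
have := @mdist_ge c0 c; rewrite eq_sym c_c0 => /(_ isT); lia.
Qed.

Lemma thread_dist_pair b u v j c p :
  2 * j <= m -> e u v -> e b u -> e b v -> e b c -> p <= m ->
  [/\ c = u -> thread_dist u v j b c p = m - p + j,
      c = v -> thread_dist u v j b c p = minn (m + p + j) (m - j + (m - p)) &
      c != u -> c != v -> thread_dist u v j b c p = minn (m + p + j)
         (minn (j + mdist u c) (m - j + mdist v c) + (m - p)) /\
         m <= mdist u c /\ m <= mdist v c].
Proof.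
move=> jm euv ebu ebv ebc pm.
have [eub evb evu] : [/\ e u b, e v b & e v u] by split; rewrite e_sym.
have nbu := negPf (edge_neq ebu); have nbv := negPf (edge_neq ebv).
have E : thread_dist u v j b c p = minn (m + p + j)
         (minn (j + mdist u c) (m - j + mdist v c) + (m - p)).
  rewrite /thread_dist nbu nbv /= /branch_dist.
  by rewrite (@mdist_edge u b) // (@mdist_edge v b) //; lia.
rewrite E; split.
- by move=> ->; rewrite mdistxx mdist_edge //; lia.
- by move=> ->; rewrite mdistxx mdist_edge //; lia.
- by move=> cu cv; rewrite !mdist_ge // eq_sym.
Qed.

(** * Threads at a known branch vertex *)

Definition arms (b : V) (p : nat) (C : {set V}) (b' c : V) (p' : nat) : Prop :=
  [/\ b' = b, c \in C & p' = p].

(** Here [t] is the number of rounds since the robber left [b]; the exact distance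
    is not recorded.  Distance one is excluded, because from there the robber can
    return to [b]: for odd [m], a probe of a pair [u v] halfway does not tell [b]
    from the point next to it on the thread to [v]. *)
Definition span (b : V) (t : nat) (C : {set V}) (b' c : V) (p : nat) : Prop :=
  [/\ b' = b, c \in C & 2 <= p <= t].

Lemma thread_winning b c S :
  (forall b' c' p, e b' c' -> p <= m -> S b' c' p -> [/\ b' = b, c' = c & 0 < p < m]) ->
  winning (points S).
Proof.
move=> inS; pose S' b' c' p := [/\ b' = b, c' = c & 0 < p < m].
apply: (@points_sub S S'); last by move=> b' c' p ebc pm /inS[].
apply: (@probe_end b) => [b' c' p []//|d].
apply: (@points_one _ (pt b c d)) => b' c' p ebc pm [[p0 [[E1 E2 _] _ _]] dE].
by subst b' c'; rewrite -dE end_dist_left.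
Qed.

Lemma arms_void b p (C : {set V}) : C = set0 -> winning (points (arms b p C)).
Proof. by move=> ->; apply: points_void => b' c p' _ _ []; rewrite inE. Qed.

Lemma arms_sub b p (C C' : {set V}) : winning (points (arms b p C')) ->
  (forall c, e b c -> c \in C -> c \in C') -> winning (points (arms b p C)).
Proof.
move=> win sub; apply: points_sub win _ => b' c p' ebc _ [E cC ->].
by subst b'; split=> //; apply: sub.
Qed.

Lemma arms_end b (C : {set V}) : winning (branches C) -> winning (points (arms b m C)).
Proof. by move=> win; apply: points_branches win _ => b' c p _ [_ cC ->]; right. Qed.

(** The probe halfway along the thread to [c0] tells whether the robber is on
    that thread, and otherwise how far he is from [b]. *)
Lemma arms_probe b c0 (C : {set V}) p : 0 < p < m -> e b c0 ->
  (forall p', p' <= m -> 0 < p' -> p' <= p.+1 -> winning (points (arms b p' (C :\ c0)))) ->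
  winning (points (arms b p C)).
Proof.
move=> pm eb0 win; pose h := m./2; have hm : 2 * h <= m by rewrite /h; lia.
have h_big : m <= (2 * h).+1 by rewrite /h; lia.
apply: (@probe_point b c0 h) => //; [lia|by move=> b' c p' [_ _ ->]|move=> d].
have inv b' c p' : e b' c -> p' <= m -> moved (arms b p C) b' c p' /\
    thread_dist b c0 h b' c p' = d ->
    [/\ b' = b, c \in C, p <= p'.+1, p' <= p.+1 & d = if c == c0 then nat_dist p' h else h + p'].
  move=> ebc p'm [[p0 [[E cC ->] l1 l2]] dE]; subst b'; split=> //.
  by rewrite -dE thread_dist_star.
case: (ltngtP d h) => [d_lt|d_gt|d_eq].
- apply: (@thread_winning b c0) => b' c p' ebc p'm /(inv _ _ _ ebc p'm)[-> _ _ _].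
  by case: eqP => [->|_]; rewrite /nat_dist; split=> //; lia.
  (* A position on the thread to [c0] and one on another thread that give the same
     result are at distances from [b] that differ by [2 * h] > 2. *)
- case: (boolP ((p <= (d - h).+1) && (d - h <= p.+1) && (d - h <= m))) => [near|far].
    have win' := win (d - h); apply: points_sub (win' _ _ _) _; try lia.
    move=> b' c p' ebc p'm /(inv _ _ _ ebc p'm)[-> cC l1 l2].
    by rewrite /arms in_setD1 cC; case: eqP => [_|_]; rewrite /nat_dist; split=> //; lia.
  apply: (@points_one _ (pt b c0 (d + h))) => b' c p' ebc p'm /(inv _ _ _ ebc p'm)[-> cC l1 l2].
  by case: eqP => [->|_] dE; [congr pt|]; move: dE; rewrite /nat_dist; lia.
- case: (eqVneq p 1) => [p1|p1].
    apply: (@points_one _ (inl b)) => b' c p' ebc p'm /(inv _ _ _ ebc p'm)[E cC l1 l2].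
    subst b'; move=> dE; have -> : p' = 0 by move: dE; rewrite /nat_dist; case: eqP; lia.
    by rewrite pt0.
  apply: (@points_one _ (pt b c0 (2 * h))) => b' c p' ebc p'm /(inv _ _ _ ebc p'm)[-> cC l1 l2].
  by case: eqP => [->|_] dE; [congr pt|]; move: dE; rewrite /nat_dist; lia.
Qed.

(** The robber needs [m - p] rounds to complete his walk along the thread, which
    is enough to eliminate the vertices of [D] one at a time: he can only reach a
    vertex of [A].  In particular, a robber who turns back towards a winning set
    is lost, which is [arms_return] below. *)
Lemma arms_winning b (D A : {set V}) p : 0 < p < m -> #|D| <= m - p ->
  winning (branches A) -> winning (points (arms b p (D :|: A))).
Proof.
have [n] := ubnP #|D :|: A|; elim: n p D A => // n IH p D A card_n pm Dp winA.
have [c0 c0DA Dc0] : exists2 c0, (D :|: A != set0) ==> (c0 \in D :|: A) &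
    D = set0 \/ c0 \in D.
  have [D0|[c0 c0D]] := set_0Vmem D; last by exists c0; rewrite ?inE c0D ?implybT; auto.
  have [A0|[c0 c0A]] := set_0Vmem A; last by exists c0; rewrite ?inE ?c0A ?orbT ?implybT; auto.
  by exists b; rewrite ?D0 ?A0 ?setU0 ?eqxx //; left.
have [DA0|DA0] := eqVneq (D :|: A) set0; first exact: arms_void.
rewrite DA0 /= in c0DA.
have card_lt : #|(D :\ c0) :|: (A :\ c0)| < n.
  by rewrite -setDUl; have := cardsD1 c0 (D :|: A); rewrite c0DA; lia.
have winA' : winning (branches (A :\ c0)) by apply: branches_sub winA (subD1set _ _).
have Dlt p' : p' <= p.+1 -> #|D :\ c0| <= m - p' /\ (p' = m -> D :\ c0 = set0).
  move=> pp'; case: Dc0 => [D0|c0D]; first by rewrite D0 set0D cards0.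
  have := cardsD1 c0 D; rewrite c0D => cD; split; first lia.
  by move=> p'm; apply/eqP; rewrite -cards_eq0; lia.
have [eb0|neb0] := boolP (e b c0).
  apply: (arms_probe pm eb0) => p' p'm p'0 pp'; rewrite setDUl.
  have [D'le D'0] := Dlt p' pp'; have [p'E|p'm'] := eqVneq p' m.
    by rewrite D'0 // set0U p'E; apply: arms_end.
  by apply: IH => //; lia.
have win' : winning (points (arms b p ((D :\ c0) :|: (A :\ c0)))).
  by apply: IH => //; case: (Dlt p (leqnSn p)).
apply: arms_sub win' _ => c ebc; rewrite -setDUl in_setD1 => ->.
by rewrite andbT; apply: contraTneq ebc => ->.
Qed.

Lemma arms_return b (A : {set V}) p : 0 < p < m -> winning (branches A) ->
  winning (points (arms b p A)).
Proof.
by move=> pm winA; rewrite -[A]set0U; apply: arms_winning; rewrite ?cards0.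
Qed.

Lemma arms_count b (C : {set V}) p k : 0 < p < m -> #|C| <= m - p + k ->
  (forall A : {set V}, #|A| <= k -> winning (branches A)) ->
  winning (points (arms b p C)).
Proof.
move=> pm Cle win; pose s := enum C.
pose D := [set x in take (m - p) s]; pose A := [set x in drop (m - p) s].
have <- : D :|: A = C.
  by apply/setP => x; rewrite !inE -mem_cat cat_take_drop mem_enum.
apply: arms_winning => //.
  by rewrite cardsE (leq_trans (card_size _)) // size_take_min; lia.
apply: win; rewrite cardsE (leq_trans (card_size _)) // size_drop -cardE; lia.
Qed.

Lemma span_probe b c0 (C : {set V}) t : t + 2 <= m -> e b c0 ->
  (forall p, 0 < p <= t.+1 -> winning (points (arms b p (C :\ c0)))) ->
  winning (points (span b t C)).
Proof.
move=> tm eb0 win; pose h := m./2; have hm : 2 * h <= m by rewrite /h; lia.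
have h_big : m <= (2 * h).+1 by rewrite /h; lia.
apply: (@probe_point b c0 h) => //; [lia|by move=> b' c p' [_ _ p'2]; lia|move=> d].
have inv b' c p' : e b' c -> p' <= m -> moved (span b t C) b' c p' /\
    thread_dist b c0 h b' c p' = d ->
    [/\ b' = b, c \in C, 0 < p', p' <= t.+1 & d = if c == c0 then nat_dist p' h else h + p'].
  move=> ebc p'm [[p0 [[E cC p02] l1 l2]] dE]; subst b'; split=> //; try lia.
  by rewrite -dE thread_dist_star.
have [d_le|d_gt] := leqP d h.
  apply: (@thread_winning b c0) => b' c p' ebc p'm /(inv _ _ _ ebc p'm)[-> _ l1 l2].
  by case: eqP => [->|_] dE; split=> //; lia.
have [d_le|d_big] := leqP d (h + t.+1); last first.
  apply: points_void => b' c p' ebc p'm /(inv _ _ _ ebc p'm)[_ _ l1 l2].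
  by rewrite /nat_dist; case: eqP => _; lia.
apply: points_sub (win (d - h) _) _; first lia.
move=> b' c p' ebc p'm /(inv _ _ _ ebc p'm)[-> cC l1 l2].
by rewrite /arms in_setD1 cC; case: eqP => [_|_]; rewrite /nat_dist; split=> //; lia.
Qed.

(** ** Testing two adjacent candidates with one probe *)

Section Pair.
Variables (b u v : V).
Hypotheses (euv : e u v) (ebu : e b u) (ebv : e b v).

Let rest (C : {set V}) := C :\ u :\ v.

Lemma in_rest (C : {set V}) c : (c \in rest C) = [&& c != u, c != v & c \in C].
Proof. by rewrite !inE andbCA. Qed.

Lemma pair_dist j c p d : 2 * j <= m -> e b c -> p <= m -> thread_dist u v j b c p = d ->
  [\/ c = u /\ d = m - p + j,
      c = v /\ d = minn (m + p + j) (m - j + (m - p)) |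
      [/\ c != u, c != v, m <= mdist u c, m <= mdist v c &
       d = minn (m + p + j) (minn (j + mdist u c) (m - j + mdist v c) + (m - p))]].
Proof.
move=> jm ebc pm <-; have [Eu Ev Ec] := thread_dist_pair jm euv ebu ebv ebc pm.
have [cu|cu] := eqVneq c u; first by constructor 1; split; rewrite // Eu.
have [cv|cv] := eqVneq c v; first by constructor 2; split; rewrite // Ev.
by have [E [? ?]] := Ec cu cv; constructor 3.
Qed.

(** A probe at [v] tells the two threads apart, except at [b].  As the robber
    cannot reach [u] in the next round, no other position is at distance [m] from
    [v]. *)
Lemma pair_threads_winning S p1 p2 : 0 < p1 -> p1 + 2 <= m -> 0 < p2 < m ->
  (forall b' c p, e b' c -> p <= m -> S b' c p ->
     b' = b /\ ((c = u /\ p = p1) \/ (c = v /\ p = p2))) ->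
  winning (points S).
Proof.
move=> p1_gt0 p1m p2m inS.
pose S' b' c p := b' = b /\ ((c = u /\ p = p1) \/ (c = v /\ p = p2)).
apply: (@points_sub S S') => //.
apply: (@probe_end v) => [b' c p [_ [[_ ->]|[_ ->]]]|d]; [lia|lia|].
have inv b' c p : e b' c -> p <= m -> moved S' b' c p /\ end_dist v b' c p = d ->
   b' = b /\ ((c = v /\ d = m - p) \/ [/\ c = u, p < m & d = m + minn p (m - p)]).
  move=> ebc pm [[p0 [[-> cE] l1 l2]] dE]; split=> //.
  case: cE => -[cE p0E]; [right|left]; subst c p0.
    have evu : e v u by rewrite e_sym.
    have evb : e v b by rewrite e_sym.
    split=> //; first lia.
    by rewrite -dE /end_dist !mdist_edge //; lia.
  by split=> //; rewrite -dE end_dist_right.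
case: (ltngtP d m) => [d_lt|d_gt|d_eq].
- apply: (@points_one _ (pt b v (m - d))) => b' c p ebc pm /(inv _ _ _ ebc pm)[-> [[-> ?]|]].
    by congr pt; lia.
  by case=> _; lia.
- apply: (@thread_winning b u) => b' c p ebc pm /(inv _ _ _ ebc pm)[-> [[-> ?]|]]; first lia.
  by case=> ->; split=> //; lia.
apply: (@points_one _ (inl b)) => b' c p ebc pm /(inv _ _ _ ebc pm)[E H].
by subst b'; have -> : p = 0 by [case: H => [[_]|[_]]; lia]; rewrite pt0.
Qed.

(** Seen from a point halfway along [u v], positions on the threads to [u] and [v]
    are at most as far as [b], all the others are farther.  So one probe eliminates
    two candidates. *)
Lemma span_pair (C : {set V}) t : t + 3 <= m ->
  winning (points (arms b 1 (rest C))) -> winning (points (span b t.+1 (rest C))) ->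
  winning (points (span b t C)).
Proof.
move=> tm win1 win2; pose h := m./2; have hm : 2 * h <= m by rewrite /h; lia.
have h_big : m <= (2 * h).+1 by rewrite /h; lia.
apply: (@probe_point u v h) => //; [lia|by move=> b' c p' [_ _ p'2]; lia|move=> d].
have inv b' c p : e b' c -> p <= m -> moved (span b t C) b' c p /\
    thread_dist u v h b' c p = d ->
    [/\ b' = b, c \in C, 0 < p, p <= t.+1 & 
     [\/ c = u /\ p = m + h - d /\ d < m + h, c = v /\ p = 2 * m - h - d /\ d < 2 * m - h|
       [/\ c != u, c != v, m + h < d & p = 1 /\ d = (m + h).+1 \/ 1 < p /\ (m + h).+1 < d]]].
  move=> ebc pm [[p0 [[E cC p02] l1 l2]] dE]; subst b'; split=> //; try lia.
  case: (pair_dist hm ebc pm dE) => [[cE ->]|[cE ->]|[cu cv mu mv ->]].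
  - by constructor 1; split=> //; lia.
  - by constructor 2; split=> //; lia.
  - by constructor 3; split=> //; lia.
case: (ltngtP d (m + h).+1) => [d_lt|d_gt|d_eq].
- have [p1_ok|p1_bad] := boolP ((m + h - d + 2 <= m) && (d < m + h)); last first.
    apply: (@thread_winning b v) => b' c p ebc pm.
    case/(inv _ _ _ ebc pm) => -> _ p0 pt [[-> ?]|[-> ?]|[_ _ ?]]; split=> //; lia.
  have [p2_ok|p2_bad] := boolP ((2 * m - h - d < m) && (d < 2 * m - h)); last first.
    apply: (@thread_winning b u) => b' c p ebc pm.
    case/(inv _ _ _ ebc pm) => -> _ p0 pt [[-> ?]|[-> ?]|[_ _ ?]]; split=> //; lia.
  apply: (@pair_threads_winning _ (m + h - d) (2 * m - h - d)); try lia.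
  move=> b' c p ebc pm; case/(inv _ _ _ ebc pm) => -> _ p0 pt.
  by case=> [[-> [-> _]]|[-> [-> _]]|[_ _ ?]]; auto; lia.
- apply: points_sub win2 _ => b' c p ebc pm; case/(inv _ _ _ ebc pm) => -> cC p0 pt.
  case=> [[-> ?]|[-> ?]|[cu cv ?]]; [lia|lia|case=> [|[p1 _]]; first lia].
  by rewrite /span in_rest cu cv; split=> //; lia.
- apply: points_sub win1 _ => b' c p ebc pm; case/(inv _ _ _ ebc pm) => -> cC p0 pt.
  case=> [[-> ?]|[-> ?]|[cu cv ?]]; [lia|lia|case=> [[p1 _]|]; last lia].
  by rewrite /arms in_rest cu cv.
Qed.

(** When the robber has just left [b], the probe has to tell a return to [b]
    from everything else.  Halfway along [u v] is the place when [m] is even;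
    for odd [m] a point a bit nearer to [u] works, at the cost of one more probe
    when the robber is slow. *)
Lemma arms1_pair (C : {set V}) :
  winning (points (arms b 1 (rest C))) -> winning (points (arms b 2 (rest C))) ->
  winning (points (arms b 1 C)).
Proof.
move=> win1 win2; pose h := m./2.
have arms_ok k S : (forall b' c p, e b' c -> p <= m -> S b' c p ->
     [/\ b' = b, c \in rest C, p = k & 0 < p <= 2]) -> winning (points S).
  move=> inS; have [k12|k12] := boolP (0 < k <= 2); last first.
    by apply: points_void => b' c p ebc pm /(inS _ _ _ ebc pm)[_ _]; lia.
  have win : winning (points (arms b k (rest C))).
    by case: k k12 {inS} => [|[|[|]]].
  by apply: points_sub win _ => b' c p ebc pm /(inS _ _ _ ebc pm)[].
have [j [jm mj]] : exists j, 2 * j <= m /\ (m = 2 * j \/ m = 2 * j + 3).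
  case: (boolP (odd m)) => om; [exists (h.-1)|exists h]; rewrite /h; lia.
apply: (@probe_point u v j) => //; [lia|by move=> b' c p' [_ _ ->]|move=> d].
have inv b' c p : e b' c -> p <= m -> moved (arms b 1 C) b' c p /\
    thread_dist u v j b' c p = d ->
    [/\ b' = b, c \in C, p <= 2 &
     [\/ c = u /\ d = m + j - p,
         c = v /\ d = minn (m + p + j) (2 * m - j - p) |
         [/\ c != u, c != v & d = m + j + p]]].
  move=> ebc pm [[p0 [[E cC p02] l1 l2]] dE]; subst b'; split=> //; try lia.
  case: (pair_dist jm ebc pm dE) => [[cE ->]|[cE ->]|[cu cv mu mv ->]].
  - by constructor 1; split=> //; lia.
  - by constructor 2; split=> //; lia.
  - by constructor 3; split=> //; lia.
case: (ltngtP d (m + j)) => [d_lt|d_gt|d_eq].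
- have [d_near|d_far] := leqP (m + j) (d + 2); last first.
    apply: points_void => b' c p ebc pm /(inv _ _ _ ebc pm)[_ _ p2].
    by case=> [[_ ?]|[_ ?]|[_ _ ?]]; lia.
  apply: (@pair_threads_winning _ (m + j - d) (m + j - d)); try lia.
  move=> b' c p ebc pm /(inv _ _ _ ebc pm)[-> _ p2].
  by case=> [[-> ?]|[-> ?]|[_ _ ?]]; split=> //; [left|right|]; try split=> //; lia.
- case: mj => mj.
    apply: (@arms_ok (d - (m + j))) => b' c p ebc pm /(inv _ _ _ ebc pm)[-> cC p2].
    by rewrite in_rest; case=> [[_ ?]|[_ ?]|[-> -> ?]]; try lia; split=> //; lia.
  have [d_near|d_far] := leqP d (m + j).+1; last first.
    apply: (@arms_ok (d - (m + j))) => b' c p ebc pm /(inv _ _ _ ebc pm)[-> cC p2].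
    by rewrite in_rest; case=> [[_ ?]|[_ ?]|[-> -> ?]]; try lia; split=> //; lia.
  (* The robber is slow: he is at distance one from [b], or on the thread to [v],
     which the next probe settles. *)
  pose S b' c p := [/\ b' = b, c \in C, 0 < p <= 2 & (c = v) \/ (p = 1 /\ c != u)].
  apply: (@points_sub _ S).
    have evb : e v b by rewrite e_sym.
    apply: (@probe_end v) => [b' c p [_ _ p2 _]|{inv}d' ]; first lia.
    have inv b' c p : e b' c -> p <= m -> moved S b' c p /\ end_dist v b' c p = d' ->
        [/\ b' = b, c \in C, p <= 3 & (c = v /\ d' = m - p) \/
           [/\ c != v, c != u, p <= 2 & d' = m + p]].
      move=> ebc pm [[p0 [[E cC p02 cE] l1 l2]] dE]; subst b'; split=> //; first lia.
      have [cv|cv] := eqVneq c v.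
        by left; split=> //; rewrite -dE cv end_dist_right // -cv.
      right; case: cE => [E|[p0E cu]]; first by rewrite E eqxx in cv.
      split=> //; first lia.
      have := @mdist_ge v c; rewrite eq_sym cv => /(_ isT).
      by rewrite -dE /end_dist (mdist_edge evb); lia.
    case: (ltngtP d' m) => [d'_lt|d'_gt|d'_eq].
    + apply: (@points_one _ (pt b v (m - d'))) => b' c p ebc pm /(inv _ _ _ ebc pm)[-> cC p3].
      by case=> [[-> ?]|[_ _ ? ?]]; [congr pt|]; lia.
    + apply: (@arms_ok (d' - m)) => b' c p ebc pm /(inv _ _ _ ebc pm)[-> cC p3].
      by rewrite in_rest cC; case=> [[_ ?]|[-> -> ? ?]]; [lia|split=> //; lia].
    + apply: (@points_one _ (inl b)) => b' c p ebc pm /(inv _ _ _ ebc pm)[E cC p3 H].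
      by subst b'; have -> : p = 0 by [case: H => [[_]|[_ _]]; lia]; rewrite pt0.
  move=> b' c p ebc pm /(inv _ _ _ ebc pm)[-> cC p2] H; split=> //.
    by case: H => [[_ ?]|[_ ?]|[_ _ ?]]; lia.
  by case: H => [[_ ?]|[-> ?]|[cu _ ?]]; [lia|left|right; split=> //; lia].
- apply: (@points_one _ (inl b)) => b' c p ebc pm /(inv _ _ _ ebc pm)[E cC p2 H].
  by subst b'; have -> : p = 0 by [case: H => [[_ ?]|[_ ?]|[_ _ ?]]; lia]; rewrite pt0.
Qed.

(** One step before the other end of the thread, a probe at distance four from [u]
    gives results in disjoint intervals for the threads to [u], to [v], and to
    other candidates that are adjacent to [u], to [v] only, or to neither.  So the
    distance to the end is known as well, and [u] and [v] are eliminated. *)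
Lemma arms_last_pair (C : {set V}) :
  (forall p, 0 < p < m -> winning (points (arms b p (rest C)))) ->
  winning (branches (rest C)) -> winning (points (arms b m.-1 C)).
Proof.
move=> win win_end.
apply: (@probe_point u v 4) => //; [lia|by move=> b' c p' [_ _ ->]; lia|move=> d].
have j8 : 2 * 4 <= m by lia.
have inv b' c p : e b' c -> p <= m -> moved (arms b m.-1 C) b' c p /\
    thread_dist u v 4 b' c p = d ->
    [/\ b' = b, c \in C, m <= p + 2 &
     [\/ c = u /\ d = m - p + 4, c = v /\ d = m - p + (m - 4) |
         [/\ c != u, c != v & [\/ d = m + 4 + (m - p), d = 2 * m - 4 + (m - p) |
              d + (m - p) = 2 * m + 4]]]].
  move=> ebc pm [[p0 [[E cC p02] l1 l2]] dE]; subst b'; split=> //; try lia.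
  case: (pair_dist j8 ebc pm dE) => [[cE ->]|[cE ->]|[cu cv mu mv dE']].
  - by constructor 1; split=> //; lia.
  - by constructor 2; split=> //; lia.
  constructor 3; split=> //.
  case: (mdist_cases u c) dE' => [[E]|[_ _ ->]|[_ _ far]]; first by rewrite E eqxx in cu.
    by constructor 1; lia.
  case: (mdist_cases v c) => [[E]|[_ _ ->]|[_ _ far']]; first by rewrite E eqxx in cv.
    by constructor 2; lia.
  by constructor 3; lia.
have rest_ok k S : (forall b' c p, e b' c -> p <= m -> S b' c p ->
     [/\ b' = b, c \in rest C, p = k & 0 < p]) -> winning (points S).
  move=> inS; have [k0|k0] := posnP k.
    by apply: points_void => b' c p ebc pm /(inS _ _ _ ebc pm)[_ _]; lia.
  have [km|km] := ltnP k m.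
    by apply: points_sub (win k _) _ => [|b' c p ebc pm /(inS _ _ _ ebc pm)[]//]; lia.
  apply: points_sub (arms_end b win_end) _ => b' c p ebc pm /(inS _ _ _ ebc pm)[-> ? ? ?].
  by split=> //; lia.
have [d_u|d_u] := leqP d 6.
  apply: (@points_one _ (pt b u (m + 4 - d))) => b' c p ebc pm /(inv _ _ _ ebc pm)[-> cC p2].
  by case=> [[-> ?]|[_ ?]|[_ _ []]]; [congr pt| |..]; lia.
have [d_v|d_v] := leqP d (m - 2).
  apply: (@points_one _ (pt b v (2 * m - 4 - d))) => b' c p ebc pm /(inv _ _ _ ebc pm)[-> cC p2].
  by case=> [[_ ?]|[-> ?]|[_ _ []]]; [|congr pt| ..]; lia.
have [d_1|d_1] := leqP d (m + 6).
  apply: (@rest_ok (2 * m + 4 - d)) => b' c p ebc pm /(inv _ _ _ ebc pm)[-> cC p2].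
  by rewrite in_rest cC; case=> [[_ ?]|[_ ?]|[-> -> []]]; split=> //; lia.
have [d_2|d_2] := leqP d (2 * m - 2).
  apply: (@rest_ok (3 * m - 4 - d)) => b' c p ebc pm /(inv _ _ _ ebc pm)[-> cC p2].
  by rewrite in_rest cC; case=> [[_ ?]|[_ ?]|[-> -> []]]; split=> //; lia.
apply: (@rest_ok (d - m - 4)) => b' c p ebc pm /(inv _ _ _ ebc pm)[-> cC p2].
by rewrite in_rest cC; case=> [[_ ?]|[_ ?]|[-> -> []]]; split=> //; lia.
Qed.

End Pair.

(** * A robber who has left a known branch vertex *)

Definition ends (M : seq (V * V)) : seq V := flatten [seq [:: a.1; a.2] | a <- M].

Definition matching (M : seq (V * V)) : bool :=
  uniq (ends M) && all (fun a => e a.1 a.2) M.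

Lemma span_winning b (D A : {set V}) t : t + 2 <= m -> #|D| <= m - t ->
  winning (branches A) -> winning (points (span b t (D :|: A))).
Proof.
move=> tm Dt winA.
have [/exists_inP[c0 c0D eb0]|noD] := boolP [exists c in D, e b c].
  apply: (span_probe tm eb0) => p pt; rewrite setDUl.
  apply: arms_winning; [lia| |exact: branches_sub winA (subD1set _ _)].
  by have := cardsD1 c0 D; rewrite c0D; lia.
have inA c : e b c -> c \in D :|: A -> c \in A.
  move=> ebc; rewrite inE => /orP[cD|//].
  by case/negP: noD; apply/exists_inP; exists c.
have [/exists_inP[c0 c0A eb0]|noA] := boolP [exists c in A, e b c]; last first.
  apply: points_void => b' c p ebc _ [E cDA _]; subst b'.
  by case/negP: noA; apply/exists_inP; exists c => //; apply: inA.
apply: (span_probe tm eb0) => p pt.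
have winA' : winning (points (arms b p A)) by apply: arms_return => //; lia.
by apply: arms_sub winA' _ => c ebc; rewrite inE => /andP[_]; apply: inA.
Qed.

Lemma card_rest u v (C : {set V}) : u != v -> u \in C -> v \in C ->
  #|C| = #|C :\ u :\ v| + 2.
Proof.
move=> uv uC vC; have := cardsD1 u C; have := cardsD1 v (C :\ u).
by rewrite uC in_setD1 vC eq_sym uv /=; lia.
Qed.

Section KnownEnd.
Variables (b : V) (k : nat).
Hypothesis k_gt0 : 0 < k.
Hypothesis win_small : forall A : {set V}, #|A| <= k -> winning (branches A).

(** The last two rounds before the end of the thread, when there are more pairs
    than time: the position is measured by a probe that eliminates one
    candidate, which makes the final probe of a pair exact. *)
Lemma span_last_pair u v (C : {set V}) t : e u v -> e b u -> e b v ->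
  u \in C -> v \in C -> t + 2 = m -> #|C| <= k + 3 ->
  winning (points (span b t C)).
Proof.
move=> euv ebu ebv uC vC tm Ck; have uv := edge_neq euv.
have CE := card_rest uv uC vC.
have tm' : t + 2 <= m by rewrite tm.
have tmE : t.+1 = m.-1 by rewrite -tm !addnS addn0.
have [/exists_inP[c0 c0C eb0]|no_c] := boolP [exists c in C :\ u :\ v, e b c].
  move: (c0C); rewrite !inE => /and3P[c0v c0u c0inC].
  have C0 : #|C :\ c0| <= k + 2.
    by move: Ck; rewrite (cardsD1 c0 C) c0inC addnC !addnS !addn0 ltnS.
  apply: (span_probe tm' eb0) => p; rewrite tmE => pt.
  have [p_lt|p_ge] := ltnP p m.-1.
    have p_m : 0 < p < m /\ k + 2 <= m - p + k by nlia.
    by apply: (@arms_count _ _ _ k); [case: p_m|apply: leq_trans C0 _; case: p_m|].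
  have -> : p = m.-1 by apply/eqP; rewrite eqn_leq p_ge; case/andP: pt => _ ->.
  have rest_small : winning (branches (C :\ c0 :\ u :\ v)).
    apply: win_small; have := @card_rest u v (C :\ c0) uv.
    rewrite !in_setD1 uC vC ![_ == c0]eq_sym c0u c0v => /(_ isT isT) E.
    by move: C0; rewrite E leq_add2r.
  by apply: (arms_last_pair euv) => // p' p'm; apply: arms_return.
apply: (span_probe tm' ebu) => p; rewrite tmE => pt.
have win_v : winning (branches [set v]) by apply: branches_one; rewrite cards1.
have pm : 0 < p < m by nlia.
apply: arms_sub (arms_return b pm win_v) _ => c ebc; rewrite !inE => /andP[cu cC].
apply: contraR no_c => cv; apply/exists_inP; exists c => //.
by rewrite !inE cv cu.
Qed.

(** The pairs of [M] are eliminated by one probe each, then the vertices of [D],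
    so that only [A] can be reached.  If there are more pairs than rounds, the
    count matters instead: in each remaining round but one two candidates are
    eliminated, and at most [k] are left in the end. *)
Lemma known_end_winning M (D A : {set V}) t :
  matching M -> {in ends M, forall c, e b c} -> winning (branches A) ->
  0 < t -> t + 2 <= m -> #|D| <= m - t - size M ->
  size M + t + 2 <= m \/ #|[set c in ends M] :|: (D :|: A)| + 1 <= 2 * (m - t) + k ->
  winning (points (arms b 1 ([set c in ends M] :|: (D :|: A)))) /\
  winning (points (span b t ([set c in ends M] :|: (D :|: A)))).
Proof.
elim: M D A t => [|[u v] M IH] D A t.
  move=> _ _ winA t0 tm; rewrite subn0 => Dt _.
  have -> : [set c in ends [::]] :|: (D :|: A) = D :|: A.
    by apply/setP => c; rewrite !inE.
  split; last exact: span_winning.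
  by apply: arms_winning => //; lia.
case/andP=> /= /and3P[]; rewrite inE negb_or => /andP[uv uM] vM uniqM /andP[euv allM].
move=> nbM winA t0 tm Dt cond.
have [ebu ebv] : e b u /\ e b v by split; apply: nbM; rewrite !inE eqxx ?orbT.
set C := _ :|: _ in cond *; pose C' := C :\ u :\ v.
pose D' := D :\ u :\ v; pose A' := A :\ u :\ v.
have C'E : C' = [set c in ends M] :|: (D' :|: A').
  apply/setP => c; rewrite !inE -/(ends M); case: (eqVneq c u) => [->|cu].
    by rewrite (negPf uM) andbF.
  by case: (eqVneq c v) => [->|cv] //=; rewrite (negPf vM).
have uC : u \in C by rewrite !inE eqxx.
have vC : v \in C by rewrite !inE eqxx orbT.
have cardC : #|C| = #|C'| + 2 by apply: card_rest.
have D'le : #|D'| <= #|D| by exact: subset_leq_card (subset_trans (subD1set _ _) (subD1set _ _)).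
have winA' : winning (branches A').
  by apply: branches_sub winA _; apply: subset_trans (subD1set _ _) (subD1set _ _).
have IH' t' : 0 < t' -> t' + 2 <= m -> t' <= t.+1 ->
    winning (points (arms b 1 C')) /\ winning (points (span b t' C')).
  move=> t'0 t'm t't; rewrite C'E; apply: IH => //.
  - by apply/andP.
  - by move=> c cM; apply: nbM; rewrite !inE cM !orbT.
  - by nlia.
  - by rewrite -C'E; case: cond => cond; [left|right]; nlia.
have [win1 _] : winning (points (arms b 1 C')) /\ winning (points (span b 1 C')).
  by apply: IH' => //; nlia.
split.
  apply: (arms1_pair euv) => //.
  have [_ win2] : winning (points (arms b 1 C')) /\ winning (points (span b 2 C')).
    by apply: IH' => //; nlia.
  by apply: points_sub win2 _ => b' c p _ _ [-> cC ->].
have [t3|t3] := leqP (t + 3) m.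
  apply: (span_pair euv) => //.
  by have [] := IH' t.+1 => //; nlia.
apply: (span_last_pair euv) => //; first nlia.
by case: cond => cond; nlia.
Qed.

End KnownEnd.

(** * Independent sets whose edges have a small cover *)

Lemma points_flip S S' : winning (points S') ->
  (forall b c p, e b c -> p <= m -> S b c p -> S' c b (m - p)) -> winning (points S).
Proof.
move=> win sub; apply: Win_sub win _ => y [b [c [p [ebc pm Sp ->]]]].
exists c, b, (m - p); split; [by rewrite e_sym|exact: leq_subr|exact: sub|].
by rewrite pt_sym.
Qed.

Lemma end_dist_branch v b c p : p <= m ->
  (end_dist v b c p %% m == 0) = (p == 0) || (p == m).
Proof.
move=> pm; case: (eqVneq p 0) => [->|p0].
  by case: (@end_dist_mod v b c 0 (leq0n m)) => ->; rewrite ?mod0n ?subn0 ?modnn.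
case: (eqVneq p m) => [->|p_m].
  by case: (@end_dist_mod v b c m (leqnn m)) => ->; rewrite ?modnn ?subnn ?mod0n.
by case: (@end_dist_mod v b c p pm) => ->; rewrite modn_small; lia.
Qed.

(** The robber left a vertex of [A] at most [t] rounds ago. *)
Definition strands (A W : {set V}) (t : nat) (c w : V) (p : nat) : Prop :=
  [/\ c \in A, w \in W & 0 < p <= t].

(** There is time to probe all the vertices of [W] before the robber can reach one
    of them.  Once the end [w] ahead of him is known, he has to turn back. *)
Lemma strands_winning (A W : {set V}) t : winning (branches A) -> [disjoint A & W] ->
  #|W| <= m - t -> winning (points (strands A W t)).
Proof.
move=> winA; have [n] := ubnP #|W|; elim: n W t => // n IH W t Wn dis Wt.
have [W0|[z zW]] := set_0Vmem W.
  by apply: points_void => c w p _ _ []; rewrite W0 inE.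
have cardW : #|W| = #|W :\ z|.+1 by rewrite (cardsD1 z) zW.
have tm : t < m by nlia.
have zA c : c \in A -> z != c.
  by move=> cA; apply: contraTneq cA => <-; rewrite (disjointFl dis zW).
apply: (@probe_end z) => [c w p [_ _]|d]; first lia.
have inv c w p : e c w -> p <= m -> moved (strands A W t) c w p /\ end_dist z c w p = d ->
    [/\ c \in A, w \in W, p <= t.+1, (d %% m == 0) = (p == 0) || (p == m) &
     w = z /\ d = m - p \/ [/\ w != z, p < m & m <= d]].
  move=> ecw pm [[p0 [[cA wW pt] l1 l2]] dE]; split=> //; [nlia| |].
    by rewrite -dE end_dist_branch.
  rewrite -dE; have [wz|wz] := eqVneq w z; [left|right].
    by subst w; split=> //; rewrite end_dist_right.
  have p_lt : p < m.
    rewrite ltn_neqAle pm andbT; apply: contra_neq wz => pE.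
    have W1 : #|W| <= 1 by nlia.
    by apply: (card_le1_eqP W1).
  split=> //; have zw : z != w by rewrite eq_sym.
  by have := end_dist_other ecw (zA _ cA) zw pm; nlia.
have [d_lt|d_ge] := ltnP d m.
  have [d0|d0] := posnP d.
    apply: (@points_one _ (inl z)) => c w p ecw pm /(inv _ _ _ ecw pm)[_ _ _ _].
    case=> [[wz dE]|[_ _]]; last nlia; subst w; have -> : p = m by nlia.
    by rewrite ptm.
  have dm : 0 < d < m by rewrite d0.
  apply: points_flip (arms_return z dm winA) _ => c w p ecw pm /(inv _ _ _ ecw pm)[cA _ _ _].
  by case=> [[wz dE]|[_ _]]; [split=> //; nlia|nlia].
have [d_mod|d_mod] := boolP (d %% m == 0).
  apply: points_branches winA _ => c w p ecw [mv dE]; left.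
  have pm : p <= m by case: mv => p0 [[_ _ ?] _ ?]; nlia.
  have [cA wW _] := inv c w p ecw pm (conj mv dE).
  rewrite d_mod => /esym pE [[_ dmp]|[_ p_lt _]]; split=> //.
    by nlia.
  by move: pE; rewrite (ltn_eqF p_lt) orbF => /eqP.
have win' : winning (points (strands A (W :\ z) t.+1)).
  apply: IH; [nlia| |nlia].
  by apply: disjointWr dis; apply: subD1set.
apply: points_sub win' _ => c w p ecw pm /(inv _ _ _ ecw pm)[cA wW pt].
rewrite (negPf d_mod) => /esym/norP[p0 _].
case=> [[_ dE]|[wz _ _]]; first by move: d_ge p0; rewrite dE; nlia.
by split=> //; [rewrite in_setD1 wz|nlia].
Qed.

Section Cover.
Variables (Z : {set V}) (F : V -> seq (V * V)).

(** The edges at the vertices of [A] are covered by the vertices of [Z] together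
    with the pairs [F c], each of which forms a triangle with [c]. *)
Definition covered (A : {set V}) : Prop :=
  [/\ {in A &, forall c c', ~~ e c c'},
      {in A, forall c, matching (F c) /\ {in ends (F c), forall w, e c w}},
      {in A, forall c w, e c w -> (w \in Z) || (w \in ends (F c))} &
      #|Z| + \sum_(c in A) size (F c) < m].

Lemma size_ends (M : seq (V * V)) : size (ends M) = 2 * size M.
Proof. by elim: M => //= a M IH; rewrite IH; nlia. Qed.

Lemma covered_found (A : {set V}) c p : covered A -> c \in A -> 0 < p < m ->
  p + size (F c) + #|Z| <= m -> winning (points (arms c p [set: V])).
Proof.
move=> [indA matA covA _] cA pm ple; have [matF nbF] := matA c cA.
pose C := [set w in ends (F c)] :|: (Z :|: set0).
have Cle : #|C| <= 2 * size (F c) + #|Z|.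
  rewrite /C setU0 (leq_trans (leq_card_setU _ _)) // leq_add2r cardsE.
  by rewrite (leq_trans (card_size _)) // size_ends.
have win1 (B : {set V}) : #|B| <= 1 -> winning (branches B) by apply: branches_one.
suff win : winning (points (arms c p C)).
  apply: arms_sub win _ => w ecw _; rewrite !inE orbF orbC.
  exact: (covA c cA w ecw).
have [pE|p2] := leqP m (p + 1).
  by apply: (@arms_count _ _ _ 1) => //; nlia.
have [win_arms win_span] : winning (points (arms c 1 C)) /\ winning (points (span c p C)).
  apply: (@known_end_winning c 1) => //; [|nlia|nlia|nlia|].
    by apply: branches_one; rewrite cards0.
  by rewrite -/C; have [le|gt] := leqP (size (F c) + p + 2) m; [left|right; nlia].
have [pE|p1] := eqVneq p 1; first by rewrite pE.
by apply: points_sub win_span _ => b' w p' _ _ [-> ? ->]; split=> //; nlia.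
Qed.

Lemma end_dist_center (A : {set V}) c0 c w p :
  {in A &, forall c c', ~~ e c c'} -> c0 \in A -> c \in A -> e c w -> p < m ->
  (c = c0 /\ end_dist c0 c w p = p) \/ (c != c0 /\ m <= end_dist c0 c w p).
Proof.
move=> indA c0A cA ecw pm; have [cc0|cc0] := eqVneq c c0; [left|right].
  by subst c; split=> //; rewrite end_dist_left // ltnW.
split=> //; have c0w : c0 != w by apply: contraTneq ecw => <-; apply: indA.
by have := @end_dist_other c0 c w p ecw; rewrite eq_sym cc0 c0w => /(_ isT isT (ltnW pm)); nlia.
Qed.

(** The vertices [c0] with [F c0] nonempty are probed first.  Such a probe costs a
    round, but it removes at least one pair from the sum, so the bound persists; and
    if the robber comes from [c0], then the time left suffices for the pairs of
    [F c0] and for [Z]. *)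
Lemma covered_strands (A : {set V}) t : covered A ->
  winning (branches A) -> 0 < t ->
  (\sum_(c in A) size (F c) = 0 -> t + #|Z| <= m) ->
  (0 < \sum_(c in A) size (F c) -> t + \sum_(c in A) size (F c) + #|Z| < m) ->
  winning (points (strands A [set: V] t)).
Proof.
have [n] := ubnP #|A|; elim: n A t => // n IH A t An covA winA t0 none some.
have [indA matA coverA sizeA] := covA.
have [sum0|sum_gt0] := posnP (\sum_(c in A) size (F c)).
  have win : winning (points (strands A (Z :\: A) t)).
    apply: strands_winning => //.
      by rewrite disjoint_sym disjoints_subset; apply/subsetP => x; rewrite !inE => /andP[].
    have := none sum0; have := subset_leq_card (subsetDl Z A); nlia.
  apply: points_sub win _ => c w p ecw _ [cA _ pt]; split=> //; rewrite inE.
  move/eqP: sum0; rewrite sum_nat_eq0 => /forall_inP/(_ c cA); rewrite size_eq0 => /eqP F0.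
  have wA : w \notin A by apply: contraL ecw; apply: indA.
  by rewrite wA; have := coverA c cA w ecw; rewrite F0 orbF.
have [c0 c0A F0] : exists2 c0, c0 \in A & 0 < size (F c0).
  apply/exists_inP; apply: contraLR sum_gt0; rewrite negb_exists_in -eqn0Ngt sum_nat_eq0.
  by move/forall_inP=> F0; apply/forall_inP => c cA; rewrite eqn0Ngt F0.
have sumE : \sum_(c in A) size (F c) = size (F c0) + \sum_(c in A :\ c0) size (F c).
  exact: big_setD1.
have tm := some sum_gt0.
have cardA : #|A| = #|A :\ c0|.+1 by rewrite (cardsD1 c0) c0A.
have covA' : covered (A :\ c0).
  split.
  - by move=> c c' /setD1P[_ cA] /setD1P[_ c'A]; apply: indA.
  - by move=> c /setD1P[_ cA]; apply: matA.
  - by move=> c /setD1P[_ cA]; apply: coverA.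
  - by nlia.
have winA' : winning (branches (A :\ c0)) by apply: branches_sub winA (subD1set _ _).
apply: (@probe_end c0) => [c w p [_ _]|d]; first nlia.
have inv c w p : e c w -> p <= m -> moved (strands A [set: V] t) c w p /\ end_dist c0 c w p = d ->
    [/\ c \in A, p < m, p <= t.+1, (d %% m == 0) = (p == 0) &
     (c = c0 /\ d = p) \/ (c != c0 /\ m <= d)].
  move=> ecw pm [[p0 [[cA _ pt] l1 l2]] <-].
  have p_lt : p < m by nlia.
  split=> //; [nlia| |exact: (end_dist_center indA)].
  by rewrite end_dist_branch // (ltn_eqF p_lt) orbF.
have [d_lt|d_ge] := ltnP d m.
  have [d0|d0] := posnP d.
    apply: (@points_one _ (inl c0)) => c w p ecw pm /(inv _ _ _ ecw pm)[_ _ _ _].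
    by case=> [[E dE]|[_ ?]]; [subst c; rewrite -dE d0 pt0|nlia].
  have [d_far|d_near] := ltnP t.+1 d.
    apply: points_void => c w p ecw pm /(inv _ _ _ ecw pm)[_ _ pt _].
    by case=> [[_ ?]|[_ ?]]; nlia.
  have win : winning (points (arms c0 d [set: V])).
    by apply: (covered_found covA) => //; nlia.
  apply: points_sub win _ => c w p ecw pm /(inv _ _ _ ecw pm)[cA _ _ _].
  by case=> [[-> ->]|[_ ?]]; [split|nlia].
have [d_mod|d_mod] := boolP (d %% m == 0).
  apply: points_branches winA' _ => c w p ecw [mv dE]; left.
  have pm : p <= m by case: mv => p0 [[_ _ ?] _ ?]; nlia.
  have [cA p_lt _] := inv c w p ecw pm (conj mv dE).
  rewrite d_mod => /esym/eqP p0 [[_ ?]|[cc0 _]]; first nlia.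
  by split=> //; rewrite in_setD1 cc0.
have win' : winning (points (strands (A :\ c0) [set: V] t.+1)).
  by apply: IH => //; nlia.
apply: points_sub win' _ => c w p ecw pm /(inv _ _ _ ecw pm)[cA p_lt pt].
rewrite (negPf d_mod) => /esym/negbT p0 [[_ ?]|[cc0 _]]; first nlia.
by split=> //; [rewrite in_setD1 cc0|nlia].
Qed.

(** In each excursion from [A] at least one vertex of [A] is eliminated, and the
    robber cannot complete it. *)
Lemma covered_winning (A : {set V}) : covered A -> winning (branches A).
Proof.
have [n] := ubnP #|A|; elim: n A => // n IH A An covA.
have [indA matA coverA sizeA] := covA.
have [A0|[a aA]] := set_0Vmem A; first by apply: branches_one; rewrite A0 cards0.
have [c0 c0A F0] : exists2 c0, c0 \in A &
    0 < \sum_(c in A) size (F c) -> 0 < size (F c0).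
  have [noF|] := boolP [forall c in A, size (F c) == 0].
    exists a => //; have -> : \sum_(c in A) size (F c) = 0 by apply/eqP; rewrite sum_nat_eq0.
    by [].
  by rewrite negb_forall_in => /exists_inP[c cA cF]; exists c; rewrite ?lt0n.
have sumE : \sum_(c in A) size (F c) = size (F c0) + \sum_(c in A :\ c0) size (F c).
  exact: big_setD1.
have cardA : #|A| = #|A :\ c0|.+1 by rewrite (cardsD1 c0) c0A.
have covA' : covered (A :\ c0).
  split.
  - by move=> c c' /setD1P[_ cA] /setD1P[_ c'A]; apply: indA.
  - by move=> c /setD1P[_ cA]; apply: matA.
  - by move=> c /setD1P[_ cA]; apply: coverA.
  - by nlia.
have winA' : winning (branches (A :\ c0)) by apply: IH => //; nlia.
apply: (@probe_end_branches c0) => d.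
have inv c w p : e c w -> p <= m -> [/\ c \in A, p <= 1 & end_dist c0 c w p = d] ->
    [/\ c \in A, p <= 1, (d %% m == 0) = (p == 0) &
     (c = c0 /\ d = p) \/ (c != c0 /\ m <= d)].
  move=> ecw pm [cA p1 <-]; have p_lt : p < m by nlia.
  split=> //; last exact: (end_dist_center indA).
  by rewrite end_dist_branch // (ltn_eqF p_lt) orbF.
have [d_lt|d_ge] := ltnP d m.
  have [d0|d0] := posnP d.
    apply: (@points_one _ (inl c0)) => c w p ecw pm /(inv _ _ _ ecw pm)[_ _ _].
    by case=> [[E dE]|[_ ?]]; [subst c; rewrite -dE d0 pt0|nlia].
  have [d_far|d_near] := ltnP 1 d.
    apply: points_void => c w p ecw pm /(inv _ _ _ ecw pm)[_ pt _].
    by case=> [[_ ?]|[_ ?]]; nlia.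
  have win : winning (points (arms c0 d [set: V])).
    by apply: (covered_found covA) => //; nlia.
  apply: points_sub win _ => c w p ecw pm /(inv _ _ _ ecw pm)[cA _ _].
  by case=> [[-> ->]|[_ ?]]; [split|nlia].
have [d_mod|d_mod] := boolP (d %% m == 0).
  apply: points_branches winA' _ => c w p ecw mv; left.
  have pm : p <= m by case: mv => _ p1 _; nlia.
  have [cA p1] := inv c w p ecw pm mv.
  rewrite d_mod => /esym/eqP p0 [[_ ?]|[cc0 _]]; first nlia.
  by split=> //; rewrite in_setD1 cc0.
have win' : winning (points (strands (A :\ c0) [set: V] 1)).
  by apply: covered_strands => //; nlia.
apply: points_sub win' _ => c w p ecw pm /(inv _ _ _ ecw pm)[cA pt].
rewrite (negPf d_mod) => /esym/negbT p0 [[_ ?]|[cc0 _]]; first nlia.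
by split=> //; [rewrite in_setD1 cc0|nlia].
Qed.

End Cover.

(** * Maximum matchings among the neighbours of a known vertex *)

Lemma endsP (M : seq (V * V)) x :
  reflect (exists2 a, a \in M & x = a.1 \/ x = a.2) (x \in ends M).
Proof.
apply: (iffP flatten_mapP) => -[a aM]; first by rewrite !inE => /orP[]/eqP->; exists a; auto.
by move=> xa; exists a; rewrite // !inE; case: xa => ->; rewrite eqxx ?orbT.
Qed.

Lemma ends_filter p (M : seq (V * V)) : subseq (ends [seq a <- M | p a]) (ends M).
Proof.
elim: M => // a M IH.
have -> : ends (a :: M) = [:: a.1; a.2] ++ ends M by [].
rewrite [filter _ _]/=; case: (p a); last exact: subseq_trans IH (suffix_subseq _ _).
by rewrite /= !eqxx.
Qed.

Lemma max_matching (C : {set V}) : exists M, [/\ matching M, {subset ends M <= C} &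
  forall M', matching M' -> {subset ends M' <= C} -> size M' <= size M].
Proof.
pose P n := [exists M : n.-tuple (V * V), matching M && all (mem C) (ends M)].
have P0 : exists n, P n by exists 0; apply/existsP; exists [tuple].
have bound n : P n -> n <= #|C|.
  case/existsP=> M /andP[/andP[uniqM _] /allP sub].
  have : size (ends M) <= #|C| by rewrite -(card_uniqP uniqM); apply/subset_leq_card/subsetP.
  by rewrite size_ends size_tuple; lia.
case: (ex_maxnP P0 bound) => n /existsP[M /andP[matM /allP subM]] max_n.
exists M; split=> // M' matM' subM'; rewrite size_tuple; apply: max_n.
by apply/existsP; exists (in_tuple M'); rewrite matM'; apply/allP.
Qed.

Section MaxMatching.
Variables (C : {set V}) (M : seq (V * V)).
Hypotheses (matM : matching M) (subM : {subset ends M <= C}).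
Hypothesis maxM : forall M', matching M' -> {subset ends M' <= C} -> size M' <= size M.

Let I := C :\: [set x in ends M].

Lemma in_unmatched x : (x \in I) = (x \notin ends M) && (x \in C).
Proof. by rewrite !inE. Qed.

Lemma unmatched_indep : {in I &, forall x y, ~~ e x y}.
Proof.
move=> x y; rewrite !in_unmatched => /andP[xM xC] /andP[yM yC].
apply/negP => exy; have /andP[uniqM allM] := matM.
have : size ((x, y) :: M) <= size M.
  apply: maxM; rewrite /matching /=.
    by rewrite inE negb_or (edge_neq exy) xM yM uniqM exy.
  by move=> z; rewrite !inE => /or3P[/eqP->|/eqP->|/subM].
by rewrite ltnn.
Qed.

(** Otherwise the pairs [x u] and [v y] could replace [u v]. *)
Lemma unmatched_common u v x y : (u, v) \in M -> x \in I -> y \in I ->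
  e u x -> e v y -> x = y.
Proof.
move=> uvM; rewrite !in_unmatched => /andP[xM xC] /andP[yM yC] eux evy.
apply/eqP/negPn/negP => xy; have /andP[uniqM allM] := matM.
have permM := perm_to_rem uvM; set M1 := rem _ _ in permM.
have ends_perm : perm_eq (ends M) (u :: v :: ends M1).
  have := perm_map (fun a : V * V => [:: a.1; a.2]) permM.
  by move/perm_flatten.
have memE z : (z \in ends M) = (z \in u :: v :: ends M1) by apply: perm_mem.
have sz : size M = (size M1).+1 by rewrite (perm_size permM).
have : size [:: (x, u), (y, v) & M1] <= size M.
  apply: maxM; rewrite /matching /=.
    move: uniqM; rewrite (perm_uniq ends_perm) /= => /and3P[].
    move: xM yM; rewrite !memE !inE !negb_or => /and3P[xu xv xM1] /and3P[yu yv yM1].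
    move=> /andP[uv uM1] vM1 uniqM1.
    rewrite xu xy xv xM1 [u == y]eq_sym yu uv uM1 yv yM1 vM1 uniqM1 /=.
    rewrite [e x u]e_sym [e y v]e_sym eux evy /=.
    by apply/allP => a /mem_rem; apply: (allP allM).
  move=> z; rewrite !inE => /or4P[/eqP->//|/eqP->|/eqP->//|/orP[/eqP->|zM1]].
  - by apply/subM; rewrite memE !inE eqxx.
  - by apply/subM; rewrite memE !inE eqxx orbT.
  - by apply/subM; rewrite memE !inE zM1 !orbT.
by rewrite /= sz ltnn.
Qed.

Let sees (x : V) := [exists c in I, e x c].
Let both (a : V * V) := sees a.1 && sees a.2.

(** A pair with a single end adjacent to unmatched vertices costs one vertex of
    the cover; if both ends are adjacent to unmatched vertices, then these are the
    same vertex [c], and the pair is counted for [c]. *)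
Lemma unmatched_covered : #|~: C| + size M < m ->
  covered (~: C :|: [set x in [seq if sees a.1 then a.1 else a.2 | a <- M & ~~ both a]])
    (fun c => [seq a <- M | both a && e a.1 c]) I.
Proof.
move=> le_m; have /andP[uniqM allM] := matM.
have both2 a c : a \in M -> c \in I -> both a -> (e a.1 c) = (e a.2 c).
  case: a => u v aM cI /andP[/exists_inP[x xI /= ux] /exists_inP[y yI /= vy]].
  apply/idP/idP => [uc|vc] /=.
    by rewrite (unmatched_common aM cI yI uc vy).
  by rewrite -(unmatched_common aM xI cI ux vc).
split; first exact: unmatched_indep.
- move=> c cI; split; first apply/andP; first split.
  + exact: subseq_uniq (ends_filter _ _) uniqM.
  + by apply/allP => a; rewrite mem_filter => /andP[_ /(allP allM)].
  + move=> w /endsP[a]; rewrite mem_filter => /andP[/andP[ba ac] aM] [->|->].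
      by rewrite e_sym.
    by rewrite e_sym -both2.
- move=> c cI w ecw; have [wC|wC] := boolP (w \in C); last by rewrite !inE wC.
  have wM : w \in ends M.
    apply: contraLR ecw => wM; apply: unmatched_indep => //.
    by rewrite in_unmatched wM.
  have /endsP[a aM wa] := wM.
  have sw : sees w by apply/exists_inP; exists c; rewrite // e_sym.
  have [ba|ba] := boolP (both a).
    apply/orP; right; apply/endsP; exists a => //.
    rewrite mem_filter aM ba /= andbT.
    by case: wa ecw => -> ecw; [|rewrite (both2 _ _ aM cI ba)]; rewrite e_sym.
  apply/orP; left; rewrite !inE; apply/orP; right; apply/mapP; exists a.
    by rewrite mem_filter ba.
  move: ba; rewrite /both; case: wa => E; rewrite -E sw //= andbT.
  by case: (sees a.1).
- apply: leq_ltn_trans le_m.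
  set Z1 := [set x in _].
  have Z1le : #|~: C :|: Z1| <= #|~: C| + count (predC both) M.
    rewrite (leq_trans (leq_card_setU _ _)) // leq_add2l cardsE.
    by rewrite (leq_trans (card_size _)) // size_map size_filter.
  have sum_le : \sum_(c in I) size [seq a <- M | both a && e a.1 c] <= count both M.
    under eq_bigr => c _ do rewrite size_filter -sum1_count big_mkcond.
    rewrite exchange_big /= -sum1_count [leqRHS]big_mkcond.
    rewrite big_seq [leqRHS]big_seq; apply: leq_sum => a aM.
    case: (boolP (both a)) => [ba|_] /=; last by rewrite big1.
    rewrite -big_mkcondr sum1_card; apply/card_le1_eqP => c c'.
    move=> /andP[cI ac] /andP[c'I ac']; move: ac; rewrite (both2 a c) // => ac.
    by case: (a) aM ac ac' => u v aM vc uc'; apply: unmatched_common aM c'I cI uc' vc.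
  by have := count_predC both M; nlia.
Qed.

End MaxMatching.

Section Known.
Variables (b : V) (k : nat).
Hypotheses (k_gt0 : 0 < k).
Hypothesis win_small : forall A : {set V}, #|A| <= k -> winning (branches A).

(** If a maximum matching [M] of [C] leaves few vertices, all but [k] of them can
    be eliminated in time.  Otherwise [size M + #|I|] exceeds [m - t + k], where [I]
    is the set of the vertices left: the cover of the edges at [I] that consists of
    the vertices outside [C] and of one item per pair has size at most
    [2 * m - size M - #|I|], which is less than [m] as [t <= k]. *)
Lemma known_winning (C : {set V}) t : {in C, forall c, e b c} ->
  0 < t <= k -> t + 2 <= m -> #|C| + 1 <= 2 * (m - t) + k ->
  winning (points (arms b 1 C)) /\ winning (points (span b t C)).
Proof.
move=> Cb tk tm Cle; have [M [matM subM maxM]] := max_matching C.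
pose I := C :\: [set x in ends M].
have CE : [set x in ends M] :|: I = C.
  apply/setP => x; rewrite !inE; case: (boolP (x \in ends M)) => //= xM.
  exact/esym/subM.
have cardM : #|[set x in ends M]| = 2 * size M.
  by rewrite cardsE -size_ends; apply/card_uniqP; case/andP: matM.
have cardC : #|C| = 2 * size M + #|I|.
  rewrite -CE cardsU cardM; suff -> : [set x in ends M] :&: I = set0.
    by rewrite cards0 subn0.
  by apply/setP => x; rewrite !inE; case: (x \in ends M).
have nbM : {in ends M, forall c, e b c} by move=> c /subM; apply: Cb.
have split_I (D A : {set V}) : D :|: A = I -> winning (branches A) ->
    #|D| <= m - t - size M -> winning (points (arms b 1 C)) /\ winning (points (span b t C)).
  move=> DA winA Dle; rewrite -CE -DA; apply: (@known_end_winning b k) => //; first by case/andP: tk.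
  by right; rewrite DA CE.
have [few|many] := leqP (size M + #|I|) (m - t + k).
  pose s := enum I.
  apply: (@split_I [set x in drop k s] [set x in take k s]).
  - apply/setP => x; rewrite in_setU [X in X || _]in_set [X in _ || X]in_set orbC.
    by rewrite -mem_cat cat_take_drop mem_enum.
  - apply: win_small; rewrite cardsE (leq_trans (card_size _)) // size_take_min geq_minl //.
  - by rewrite cardsE (leq_trans (card_size _)) // size_drop -cardE; nlia.
apply: (@split_I set0 I); [by rewrite set0U| |by rewrite cards0].
apply: covered_winning; apply: unmatched_covered => //.
by have := cardsC C; nlia.
Qed.

End Known.

(** * A robber who has left an unknown branch vertex *)

(** In the last round, for [s = m - 1], the bound allows [k + 1] candidates, one of
    which can still be eliminated. *)
Lemma found_winning k v (C : {set V}) s r : 0 < k ->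
  (forall A : {set V}, #|A| <= k -> winning (branches A)) ->
  0 < r <= s -> s <= k -> s < m -> #|[set c in C | e v c]| + 1 + 2 * s <= 2 * m + k ->
  winning (points (arms v r C)).
Proof.
move=> k0 win rs sk sm Cle; pose C' := [set c in C | e v c].
suff win' : winning (points (arms v r C')).
  by apply: arms_sub win' _ => c evc cC; rewrite inE cC.
have [sE|s2] := leqP m (s + 1).
  by apply: (@arms_count _ _ _ k) => //; rewrite -/C' in Cle; nlia.
have [win1 win_span] : winning (points (arms v 1 C')) /\ winning (points (span v s C')).
  apply: (known_winning k0 win) => [c| | |]; first by rewrite inE => /andP[].
  - by nlia.
  - by nlia.
  - by rewrite -/C' in Cle; nlia.
have [->//|r1] := eqVneq r 1.
by apply: points_sub win_span _ => b c p _ _ [-> cC ->]; split=> //; nlia.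
Qed.

(** The robber left a branch vertex at most [t] rounds ago. *)
Definition departed (S T : {set V}) (t : nat) (b c : V) (p : nat) : Prop :=
  [/\ b \in S, c \notin T & 0 < p <= t].

(** A probe at a candidate [v] for the vertex that was left shows whether [v] is
    an end of the thread.  If it is the end ahead of the robber, then he has to go
    back to a smaller set. *)
Lemma departed_after v (S T : {set V}) s d :
  v \in S -> [disjoint S & T] -> 0 < s < m ->
  winning (branches (S :\ v)) ->
  (forall r, 0 < r <= s -> winning (points (arms v r (~: T)))) ->
  (m <= d -> winning (points (fun b c p =>
     departed (S :\ v) (v |: T) s b c p /\ end_dist v b c p = d))) ->
  winning (points (fun b c p => [/\ b \in S, c \notin T, p <= s & end_dist v b c p = d])).
Proof.
move=> vS dis sm win_b win_found win_rest.
have inv b c p : e b c -> p <= m ->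
    [/\ b \in S, c \notin T, p <= s & end_dist v b c p = d] ->
    [/\ b \in S, c \notin T, p <= s, (d %% m == 0) = (p == 0) &
    [\/ b = v /\ d = p, [/\ b != v, c = v & d = m - p] |
        [/\ b != v, c != v & m <= d]]].
  move=> ebc pm [bS cT ps dE]; have p_lt : p < m by nlia.
  have dE0 : (d %% m == 0) = (p == 0) by rewrite -dE end_dist_branch // (ltn_eqF p_lt) orbF.
  split=> //; have [bv|bv] := eqVneq b v.
    by constructor 1; subst b; rewrite -dE end_dist_left.
  have [cv|cv] := eqVneq c v.
    by constructor 2; subst c; rewrite -dE end_dist_right.
  constructor 3; split=> //; rewrite eq_sym in bv; rewrite eq_sym in cv.
  by have := end_dist_other ebc bv cv pm; nlia.
have [d_lt|d_ge] := ltnP d m.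
  have [d0|d0] := posnP d.
    apply: (@points_one _ (inl v)) => b c p ebc pm /(inv _ _ _ ebc pm)[_ _ ps _].
    case=> [[bv dp]|[_ _ dp]|[_ _ ?]]; [|nlia|nlia].
    by subst b; rewrite -dp d0 pt0.
  have dm : 0 < d < m by rewrite d0.
  have [d_s|d_s] := leqP d s; last first.
    apply: points_flip (arms_return v dm win_b) _ => b c p ebc pm /(inv _ _ _ ebc pm).
    case=> bS _ ps _ [[_ ?]|[bv cv dp]|[_ _ ?]]; [nlia| |nlia].
    by split; [|rewrite in_setD1 bv|].
  apply: Win_sub (win_found d _) _ => [|y [b [c [p [ebc pm /(inv _ _ _ ebc pm)]]]]].
    by rewrite d0.
  case=> bS cT ps _ H yE; case: H => [[bv dp]|[bv cv dp]|[_ _ ?]]; last nlia.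
    by exists v, c, d; subst b p; split=> //; split; rewrite ?inE.
  exists v, b, d; split; [by rewrite -cv e_sym|exact: ltnW| |].
    by split=> //; rewrite inE (disjointFr dis bS).
  by rewrite yE pt_sym // cv; congr pt; nlia.
have [d_mod|d_mod] := boolP (d %% m == 0).
  apply: points_branches win_b _ => b c p ebc S_bcp; left.
  have pm : p <= m by case: S_bcp => _ _ ps _; nlia.
  have [bS _ ps] := inv b c p ebc pm S_bcp.
  rewrite d_mod => /esym/eqP p0 [[_ ?]|[bv _ _]|[bv _ _]]; first nlia.
    by rewrite in_setD1 bv.
  by rewrite in_setD1 bv.
apply: points_sub (win_rest d_ge) _ => b c p ebc pm S_bcp.
have [bS cT ps] := inv b c p ebc pm S_bcp.
rewrite (negPf d_mod) => /esym/negbT p0 H.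
have p_gt0 : 0 < p by rewrite lt0n.
split; last by case: S_bcp.
case: H => [[_ ?]|[_ _ ?]|[bv cv _]]; [nlia|nlia|].
by split; rewrite ?in_setD1 ?in_setU1 ?negb_or ?bv ?cv // p_gt0.
Qed.

Lemma departed_probe v (S T : {set V}) t :
  v \in S -> [disjoint S & T] -> t.+1 < m ->
  winning (branches (S :\ v)) ->
  (forall r, 0 < r <= t.+1 -> winning (points (arms v r (~: T)))) ->
  (forall d, m <= d -> winning (points (fun b c p =>
     departed (S :\ v) (v |: T) t.+1 b c p /\ end_dist v b c p = d))) ->
  winning (points (departed S T t)).
Proof.
move=> vS dis tm win_b win_found win_rest.
apply: (@probe_end v) => [b c p [_ _]|d]; first by nlia.
apply: points_sub (departed_after vS dis _ win_b win_found (win_rest d)) _; first by rewrite tm.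
by move=> b c p _ _ [[p0 [[bS cT pt] l1 l2]] dE]; split=> //; nlia.
Qed.

Lemma branches_probe v (B : {set V}) : v \in B -> winning (branches (B :\ v)) ->
  winning (points (arms v 1 [set: V])) ->
  (forall d, m <= d -> winning (points (fun b c p =>
     departed (B :\ v) [set v] 1 b c p /\ end_dist v b c p = d))) ->
  winning (branches B).
Proof.
move=> vB win_b win_found win_rest; apply: (@probe_end_branches v) => d.
have win := @departed_after v B set0 1 d vB.
apply: points_sub (win _ _ win_b _ _) _.
- by rewrite disjoint_sym disjoints_subset sub0set.
- by nlia.
- by move=> [|[|r]] // _; rewrite setC0.
- by rewrite setU0; apply: win_rest.
- by move=> b c p _ _ [bB p1 dE]; split; rewrite ?inE.
Qed.

Definition off (T : {set V}) (b c : V) (p : nat) : Prop :=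
  [/\ b \notin T, c \notin T & 0 < p < m].

(** Branch vertices are probed in turn: a robber who stays inside a thread is
    found, and one who reaches a branch vertex is seen to do so. *)
Lemma off_winning (T : {set V}) v : v \notin T ->
  winning (branches (~: (v |: T))) -> winning (points (off T)).
Proof.
have [n] := ubnP #|~: T|; elim: n T v => // n IH T v Tn vT win_b.
apply: (@probe_end v) => [b c p []//|d].
have inv b c p : e b c -> p <= m -> moved (off T) b c p /\ end_dist v b c p = d ->
    [/\ b \notin T, c \notin T, (d %% m == 0) = (p == 0) || (p == m) &
    [\/ b = v /\ d = p, [/\ b != v, c = v & d = m - p] |
        [/\ b != v, c != v & m <= d]]].
  move=> ebc pm [[p0 [[bT cT p0m] _ _]] dE].
  split=> //; first by rewrite -dE end_dist_branch.
  have [bv|bv] := eqVneq b v.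
    by constructor 1; subst b; rewrite -dE end_dist_left.
  have [cv|cv] := eqVneq c v.
    by constructor 2; subst c; rewrite -dE end_dist_right.
  constructor 3; split=> //; rewrite eq_sym in bv; rewrite eq_sym in cv.
  by have := end_dist_other ebc bv cv pm; nlia.
have [d_lt|d_ge] := ltnP d m.
  have [d0|d0] := posnP d.
    apply: (@points_one _ (inl v)) => b c p ebc pm /(inv _ _ _ ebc pm)[_ _ _].
    case=> [[bv dp]|[_ cv dp]|[_ _ ?]]; last nlia.
      by subst b; rewrite -dp d0 pt0.
    by subst c; have -> : p = m by [nlia]; rewrite ptm.
  have dm : 0 < d < m by rewrite d0.
  apply: Win_sub (arms_return v dm win_b) _ => y [b [c [p [ebc pm /(inv _ _ _ ebc pm)]]]].
  case=> bT cT _ H yE; case: H => [[bv dp]|[bv cv dp]|[_ _ ?]]; last nlia.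
    exists v, c, d; subst b p; split=> //; split; rewrite ?inE ?negb_or ?cT ?andbT //.
    by rewrite eq_sym edge_neq.
  exists v, b, d; split; [by rewrite -cv e_sym|exact: ltnW| |].
    by split; rewrite ?inE ?negb_or ?bv ?bT.
  by rewrite yE pt_sym // cv; congr pt; nlia.
have [d_mod|d_mod] := boolP (d %% m == 0).
  apply: points_branches win_b _ => b c p ebc S_bcp.
  have pm : p <= m by case: S_bcp => -[p0 [[_ _ ?] _ ?]] _; nlia.
  have [bT cT] := inv b c p ebc pm S_bcp.
  rewrite d_mod !inE !negb_or bT cT !andbT => /esym/orP[/eqP->|/eqP->] H; [left|right].
    by split=> //; case: H => [[_ ?]|[]//|[]//]; nlia.
  split=> //; case: H => [[bv _]|[_ _ ?]|[_ cv _]] //; last nlia.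
  by rewrite eq_sym -bv edge_neq.
have inner b c p : e b c -> p <= m -> moved (off T) b c p /\ end_dist v b c p = d ->
    off (v |: T) b c p.
  move=> ebc pm /(inv _ _ _ ebc pm)[bT cT].
  rewrite (negPf d_mod) => /esym/norP[p0 p_m] H.
  case: H => [[_ ?]|[_ _ ?]|[bv cv _]].
  - by case/negP: p_m; rewrite eqn_leq pm; nlia.
  - by case/negP: p0; nlia.
  by split; rewrite ?in_setU1 ?negb_or ?bv ?cv // lt0n p0 ltn_neqAle p_m.
have [T_full|[v' v'T]] := set_0Vmem (~: (v |: T)).
  apply: points_void => b c p ebc pm /(inner _ _ _ ebc pm)[bT _ _].
  by have := in_set0 b; rewrite -T_full inE bT.
rewrite inE in v'T; apply: points_sub inner; apply: IH v'T _.
  have := cardsD1 v (~: T); have -> : ~: T :\ v = ~: (v |: T).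
    by apply/setP => x; rewrite !inE negb_or.
  by rewrite inE vT; nlia.
by apply: branches_sub win_b _; rewrite setCS subsetUr.
Qed.

(** * The size of the set of candidate branch vertices decreases *)

Lemma card_nbrs v (T : {set V}) : v \notin T -> #|[set c in ~: T | e v c]| + #|T| < #|V|.
Proof.
move=> vT; have sub : [set c in ~: T | e v c] \subset ~: (v |: T).
  apply/subsetP => c; rewrite !inE negb_or => /andP[-> evc].
  by rewrite eq_sym edge_neq.
have := subset_leq_card sub; have := cardsC (v |: T).
by rewrite cardsU1 vT /=; nlia.
Qed.

Section SmallSets.
Variable k : nat.
Hypotheses (k_gt0 : 0 < k).
Hypothesis win_small : forall A : {set V}, #|A| <= k -> winning (branches A).

Lemma arms_any y (C : {set V}) : winning (branches C) ->
  winning (points (fun b c p => [/\ b = y, c \in C & 0 < p < m])).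
Proof.
move=> winC; apply: (@probe_end y) => [b c p []//|d].
have inv b c p : e b c -> p <= m ->
    moved (fun b c p => [/\ b = y, c \in C & 0 < p < m]) b c p /\ end_dist y b c p = d ->
    [/\ b = y, c \in C & p = d].
  move=> ebc pm [[p0 [[E cC _] _ _]] <-]; subst b.
  by split=> //; rewrite end_dist_left.
have [d0|d0] := posnP d.
  apply: (@points_one _ (inl y)) => b c p ebc pm /(inv _ _ _ ebc pm)[E _ ->].
  by subst b; rewrite d0 pt0.
have [d_lt|d_ge] := ltnP d m.
  apply: points_sub (arms_return y _ winC) inv; first by rewrite d0.
apply: points_branches winC _ => b c p ebc S_bcp; right.
have pm : p <= m.
  case: S_bcp => -[p0 [[E cC pm] l1 l2]] _; nlia.
have [_ cC pd] := inv b c p ebc pm S_bcp.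
by split=> //; nlia.
Qed.

(** When a single candidate [y] for the vertex that was left remains, the result
    of the last probe, at [x], is still to be used.  Up to the last moment it
    tells whether the robber has just left [y].  At the last moment it separates
    the neighbours of [x]. *)
Lemma last_candidate x y (T : {set V}) s d : 
  s <= k -> 0 < s < m -> x \in T ->
  #|[set c in ~: T | e y c]| + 1 + 2 * s <= 2 * m + k ->
  (s + 2 <= m \/ [/\ x != y, ~~ e x y & exists2 Q : {set V}, #|Q| <= k.+1 &
     forall c, e x c || e y c -> c \in Q]) ->
  winning (points (fun b c p => departed [set y] T s b c p /\ end_dist x b c p = d)).
Proof.
move=> sk sm xT Cle cond; pose C := [set c in ~: T | e y c].
have inC b c p : e b c -> departed [set y] T s b c p -> [/\ b = y, c \in C & 0 < p <= s].
  by move=> ebc [/set1P E cT ps]; subst b; rewrite !inE cT.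
have [s2|s2] := leqP (s + 2) m.
  have [d1|d1] := boolP ((d %% m == 1) || (d %% m == m - 1)).
    have s11 : 0 < 1 <= s by nlia.
    have sm' : s < m by case/andP: sm.
    apply: points_sub (found_winning k_gt0 win_small s11 sk sm' Cle) _.
    move=> b c p ebc pm [[/set1P E cT ps] dE]; split; rewrite ?inE //.
    by move: d1; rewrite -dE; case: (@end_dist_mod x b c p pm) => ->; rewrite modn_small; nlia.
  have C_nb : {in C, forall c, e y c} by move=> c; rewrite inE => /andP[].
  have s0k : 0 < s <= k by nlia.
  have Cle' : #|C| + 1 <= 2 * (m - s) + k by rewrite -/C in Cle; nlia.
  have [_ win] := known_winning k_gt0 win_small C_nb s0k s2 Cle'.
  apply: points_sub win _ => b c p ebc pm [/(inC _ _ _ ebc)[E cC ps] dE]; split=> //.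
  have p1 : p != 1.
    apply: contraNneq d1 => pE; rewrite -dE.
    by case: (@end_dist_mod x b c p pm) => ->; rewrite pE modn_small ?eqxx ?orbT //; nlia.
  by nlia.
case: cond => [s2'|[xy nexy [Q Qk inQ]]]; first by nlia.
have CQ : C \subset Q by apply/subsetP => c; rewrite inE => /andP[_ eyc]; rewrite inQ ?eyc ?orbT.
have xy_far : 2 * m <= mdist x y by apply: mdist_far.
have dist_nb c p : e y c -> e x c -> p <= m -> end_dist x y c p = 2 * m - p.
  by move=> eyc exc pm; rewrite /end_dist (mdist_edge exc); nlia.
have dist_far c p : c \in C -> e y c -> ~~ e x c -> 0 < p -> 2 * m <= end_dist x y c p.
  move=> cC eyc exc p0; have xc : x != c.
    by apply: contraTneq cC => <-; rewrite !inE xT.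
  by have := mdist_far xc exc; rewrite /end_dist; nlia.
have [d_near|d_far] := ltnP d (2 * m).
  have [md|md] := leqP d m.
    apply: points_void => b c p ebc pm [/(inC _ _ _ ebc)[E cC ps] dE]; subst b.
    have [exc|exc] := boolP (e x c).
      by move: dE; rewrite dist_nb //; nlia.
    have p0 : 0 < p by case/andP: ps.
    by have := dist_far c p cC ebc exc p0; rewrite dE; nlia.
  have win : winning (points (arms y (2 * m - d) C)).
    apply: (@arms_count _ _ _ k) => //; first by nlia.
    by have := subset_leq_card CQ; nlia.
  apply: points_sub win _ => b c p ebc pm [/(inC _ _ _ ebc)[E cC ps] dE]; subst b.
  split=> //; have [exc|exc] := boolP (e x c).
    by move: dE; rewrite dist_nb //; nlia.
  have p0 : 0 < p by case/andP: ps.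
  by have := dist_far c p cC ebc exc p0; rewrite dE; nlia.
have [z exz] := has_nbr x.
have win : winning (branches (Q :\ z)).
  by apply: win_small; have := cardsD1 z Q; rewrite inQ ?exz //; nlia.
apply: points_sub (arms_any y win) _ => b c p ebc pm.
case=> /(inC _ _ _ ebc)[E cC ps] dE; subst b; split=> //; last by nlia.
rewrite in_setD1 (subsetP CQ) // andbT; apply: contraTneq d_far => cz; subst c.
by rewrite -dE dist_nb //; nlia.
Qed.

(** Candidates are probed one by one.  The robber either is found early, or has
    few vertices to go to: those not in an independent set containing [S] in the
    first case, those not probed yet in the second. *)
Lemma departed_winning (S T : {set V}) t : #|S| <= k -> [disjoint S & T] ->
  0 < t -> t + #|S| <= k.+1 -> t + #|S| <= m -> (#|S| = 1 -> t = 1) ->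
  ({in S &, forall x y, ~~ e x y} /\ (exists2 Q : {set V}, #|Q| + k < 2 * m &
     {in S, forall v c, e v c -> c \in Q})) \/
  (t <= #|T| /\ t + #|S| <= k /\ t + #|S| < m) ->
  winning (points (departed S T t)).
Proof.
have [n] := ubnP #|S|; elim: n S T t => // n IH S T t Sn Sk dis t0 tSk tSm S1 cond.
have [S0|[v vS]] := set_0Vmem S.
  by apply: points_void => b c p _ _ []; rewrite S0 inE.
have cardS : #|S| = #|S :\ v|.+1 by rewrite (cardsD1 v) vS.
have vT : v \notin T by rewrite (disjointFr dis vS).
have count w (T' : {set V}) : w \in S -> w \notin T' -> #|T| <= #|T'| -> 1 < #|S| ->
    #|[set c in ~: T' | e w c]| + 1 + 2 * t.+1 <= 2 * m + k.
  move=> wS wT TT' S2; case: cond => [[_ [Q Qk inQ]]|[tT [tSk' tSm']]].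
    have : #|[set c in ~: T' | e w c]| <= #|Q|.
      by apply/subset_leq_card/subsetP => c; rewrite inE => /andP[_]; apply: inQ.
    by nlia.
  by have := card_nbrs wT; nlia.
have [S_1|S_2] := leqP #|S| 1.
  have t1 : t = 1 by apply: S1; nlia.
  have SE w : w \in S -> w = v by move=> wS; apply: (card_le1_eqP S_1).
  have win : winning (points (arms v 1 (~: T))).
    apply: (@found_winning k _ _ 1) => //.
    have : #|[set c in ~: T | e v c]| + 1 < 2 * m.
      case: cond => [[_ [Q Qk inQ]]|[tT _]]; last by have := card_nbrs vT; nlia.
      have : #|[set c in ~: T | e v c]| <= #|Q|.
        by apply/subset_leq_card/subsetP => c; rewrite inE => /andP[_]; apply: inQ.
      by nlia.
    by nlia.
  apply: points_sub win _ => b c p _ _ [/SE -> cT pt]; split; rewrite ?inE //.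
  by rewrite t1 in pt; nlia.
have disT' : [disjoint S :\ v & v |: T].
  rewrite disjoint_sym disjoints_subset; apply/subsetP => x.
  rewrite !inE negb_and negbK => /orP[/eqP->|xT]; first by rewrite eqxx.
  by rewrite (disjointFl dis xT) orbT.
have cardT' : #|v |: T| = #|T|.+1 by rewrite cardsU1 vT.
apply: (departed_probe vS dis).
- by nlia.
- by apply: win_small; nlia.
- move=> r rs; apply: (@found_winning k _ _ t.+1) => //; [nlia|nlia|].
  exact: count.
move=> d md; have [S'1|S'2] := leqP #|S :\ v| 1; last first.
  have win : winning (points (departed (S :\ v) (v |: T) t.+1)).
    apply: IH => //; [nlia|nlia|nlia|nlia|by move=> ?; nlia|].
    case: cond => [[indS [Q Qk inQ]]|[tT [tSk' tSm']]]; [left|right]; last by split; nlia.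
    split; first by move=> x y /setD1P[_ xS] /setD1P[_ yS]; apply: indS.
    by exists Q => // x /setD1P[_]; apply: inQ.
  by apply: points_sub win _ => b c p _ _ [].
have /cards1P[y S'E] : #|S :\ v| == 1 by apply/eqP; nlia.
have yS' : y \in S :\ v by rewrite S'E inE.
have [yv yS] := setD1P yS'.
rewrite S'E; apply: last_candidate.
- by nlia.
- by nlia.
- by rewrite !inE eqxx.
- by apply: count; rewrite ?(disjointFr disT' yS') // cardT'.
case: cond => [[indS [Q Qk inQ]]|[tT [tSk' tSm']]]; last by left; nlia.
have [s2|s2] := leqP (t.+1 + 2) m; [left|right] => //.
split; [by rewrite eq_sym|exact: indS|exists Q; first by nlia].
by move=> c /orP[]; apply: inQ.
Qed.

(** By the time the robber can reach the other end of his thread, [m] vertices have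
    been excluded for it, which leaves at most [m] and hence at most [k] of them. *)
Lemma departed_large (S T : {set V}) t : m <= k -> #|S| <= k.+1 -> [disjoint S & T] ->
  0 < t < m -> #|T| = t -> m < #|S| + t -> winning (points (departed S T t)).
Proof.
move=> mk; have [n] := ubnP (m - t); elim: n S T t => // n IH S T t tn Sk dis tm Tt St.
have [S0|[v vS]] := set_0Vmem S; first by rewrite S0 cards0 in St; nlia.
have cardS : #|S| = #|S :\ v|.+1 by rewrite (cardsD1 v) vS.
have vT : v \notin T by rewrite (disjointFr dis vS).
have cardT' : #|v |: T| = #|T|.+1 by rewrite cardsU1 vT.
have [t_last|t_small] := leqP m t.+1.
  have win : winning (points (off T)).
    apply: (off_winning vT); apply: win_small; have := cardsC (v |: T); nlia.
  apply: points_sub win _ => b c p _ _ [bS cT pt]; split=> //.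
    by rewrite (disjointFr dis bS).
  by nlia.
have disT' : [disjoint S :\ v & v |: T].
  rewrite disjoint_sym disjoints_subset; apply/subsetP => x.
  rewrite !inE negb_and negbK => /orP[/eqP->|xT]; first by rewrite eqxx.
  by rewrite (disjointFl dis xT) orbT.
apply: (departed_probe vS dis t_small).
- by apply: win_small; nlia.
- move=> r rs; apply: (@found_winning k _ _ t.+1) => //; [nlia|].
  by have := card_nbrs vT; nlia.
move=> d md; have win : winning (points (departed (S :\ v) (v |: T) t.+1)).
  by apply: IH => //; nlia.
by apply: points_sub win _ => b c p _ _ [].
Qed.

(** A probe on the thread between two adjacent candidates, before the robber has
    gone farther than one step, decides whether he comes from one of them.
    Distance four works as [4] and [m - 4] are not congruent modulo [m] to [3], [5],
    [m - 3] or [m - 5]: so it also tells whether he has left. *)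
Lemma branches_pair u v (B : {set V}) : u \in B -> v \in B -> e u v ->
  winning (points (arms u 1 (~: [set v]))) -> winning (points (arms v 1 (~: [set u]))) ->
  winning (branches (B :\ u :\ v)) ->
  winning (points (departed (B :\ u :\ v) [set u] 1)) -> winning (branches B).
Proof.
move=> uB vB euv win_u win_v win_b win_rest; have uv := edge_neq euv.
apply: (@probe_branches u v 4) => // [|d]; first by lia.
have mod4 w p : p <= 1 -> (branch_dist u v 4 w + p) %% m = 4 + p \/
    (branch_dist u v 4 w + p) %% m = m - 4 + p.
  move=> p1; rewrite /branch_dist /mdist.
  case: (leqP (4 + m * gdist e u w) (m - 4 + m * gdist e v w)) => _; [left|right].
    by rewrite [4 + _]addnC -addnA mulnC modnMDl modn_small //; nlia.
  by rewrite [m - 4 + _]addnC -addnA mulnC modnMDl modn_small //; nlia.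
have mod4' w p : p <= 1 -> (branch_dist u v 4 w + (m - p)) %% m = (4 + m - p) %% m \/
    (branch_dist u v 4 w + (m - p)) %% m = m - 4 - p.
  move=> p1; rewrite /branch_dist /mdist.
  case: (leqP (4 + m * gdist e u w) (m - 4 + m * gdist e v w)) => _; [left|right].
    by rewrite [4 + _]addnC -addnA mulnC modnMDl addnBA //; nlia.
  rewrite [m - 4 + _]addnC -addnA mulnC modnMDl.
  have -> : m - 4 + (m - p) = m + (m - 4 - p) by nlia.
  by rewrite modnDl modn_small //; nlia.
have inv b c p : e b c -> p <= m -> [/\ b \in B, p <= 1 & thread_dist u v 4 b c p = d] ->
    [/\ b \in B, p <= 1 &
    [\/ b = u /\ (c = v /\ d + p = 4 \/ c != v /\ d = 4 + p),
        b = v /\ (c = u /\ d + p = m - 4 \/ c != u /\ d = m - 4 + p) |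
        [/\ b != u, b != v & (c = u /\ d + p = m + 4) \/
          [/\ c != u, m + 4 <= d & (d %% m == 4) || (d %% m == m - 4) = (p == 0)]]]].
  move=> ebc pm [bB p1 dE]; split=> //.
  have evu : e v u by rewrite e_sym.
  have du : branch_dist u v 4 u = 4 by rewrite /branch_dist mdistxx (mdist_edge evu); nlia.
  have dv : branch_dist u v 4 v = m - 4 by rewrite /branch_dist mdistxx (mdist_edge euv); nlia.
  have far w : w != u -> w != v -> m + 4 <= branch_dist u v 4 w.
    move=> wu wv; rewrite /branch_dist; have := @mdist_ge u w; have := @mdist_far v w.
    rewrite ![_ == w]eq_sym wu wv => f1 /(_ isT) f2.
    have [evw|nevw] := boolP (e v w); last by have := f1 isT nevw; nlia.
    by rewrite (mdist_edge evw); nlia.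
  have nbc := edge_neq ebc; rewrite -dE /thread_dist.
  have [bu|bu] := eqVneq b u.
    constructor 1; split=> //; rewrite /= bu in nbc *; rewrite (negPf uv) /= du.
    have [cv|cv] := eqVneq c v; [left|right]; split=> //; first by rewrite /nat_dist; nlia.
    by have := far c; rewrite eq_sym nbc cv => /(_ isT isT); nlia.
  have [bv|bv] := eqVneq b v.
    constructor 2; split=> //; rewrite /= bv in nbc *; rewrite dv.
    have [cu|cu] := eqVneq c u; [left|right]; split=> //; first by rewrite /nat_dist; nlia.
    have := far c; rewrite [c == v]eq_sym nbc cu => /(_ isT isT); nlia.
  constructor 3; split=> //=; have far_b := far b bu bv.
  have [cu|cu] := eqVneq c u; [left|right]; split=> //.
    by rewrite cu du; nlia.
    have [cv|cv] := eqVneq c v; first by rewrite cv dv; nlia.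
    by have := far c cu cv; nlia.
  set dd := minn _ _.
  have : [\/ dd %% m = 4 + p, dd %% m = m - 4 + p, dd %% m = (4 + m - p) %% m | dd %% m = m - 4 - p].
    rewrite /dd; case: leqP => _.
      by case: (mod4 b p p1) => ->; [constructor 1|constructor 2].
    by case: (mod4' c p p1) => ->; [constructor 3|constructor 4].
  clearbody dd; case: p p1 dE pm => [|[|//]] _ _ _; rewrite ?addn0 ?subn0 ?modnDr.
    by rewrite [4 %% m]modn_small; [case=> ->; rewrite eqxx ?orbT|nlia].
  have -> : (4 + m - 1) %% m = 3 by have -> : 4 + m - 1 = m + 3 by [nlia]; rewrite modnDl modn_small; nlia.
  by case=> ->; apply/negbTE/norP; split; apply/eqP; nlia.
have [d5|d5] := ltnP d 5.
  apply: (@points_one _ (pt u v (4 - d))) => b c p ebc pm /(inv _ _ _ ebc pm)[_ p1].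
  case=> [[E [[cv dp]|[_ dp]]]|[_ [[_ ?]|[_ ?]]]|[_ _ [[_ ?]|[_ ? _]]]]; try nlia; subst b.
    by rewrite cv; congr pt; nlia.
  by have [-> ->] : p = 0 /\ d = 4 by [nlia]; rewrite subnn !pt0.
have [d6|d6] := ltnP d 6.
  apply: points_sub win_u _ => b c p ebc pm /(inv _ _ _ ebc pm)[_ p1].
  case=> [[E [[cv dp]|[cv dp]]]|[_ [[_ ?]|[_ ?]]]|[_ _ [[_ ?]|[_ ? _]]]]; try nlia.
  by split=> //; [rewrite !inE|nlia].
have [d7|d7] := leqP d (m - 4).
  apply: (@points_one _ (pt v u (m - 4 - d))) => b c p ebc pm /(inv _ _ _ ebc pm)[_ p1].
  have evu : e v u by rewrite e_sym.
  case=> [[E [[cv dp]|[_ dp]]]|[E [[cu dp]|[_ dp]]]|[_ _ [[_ ?]|[_ ? _]]]]; try nlia; subst b.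
    by rewrite cu; congr pt; nlia.
  by have [-> ->] : p = 0 /\ d = m - 4 by [nlia]; rewrite subnn !pt0.
have [d8|d8] := ltnP d (m + 3).
  apply: points_sub win_v _ => b c p ebc pm /(inv _ _ _ ebc pm)[_ p1].
  case=> [[_ [[_ dp]|[_ dp]]]|[E [[cu ?]|[cu ?]]]|[_ _ [[_ ?]|[_ ? _]]]]; try nlia.
  by split=> //; [rewrite !inE|nlia].
have [d9|d9] := ltnP d (m + 4).
  have mm : 0 < m.-1 < m by nlia.
  apply: points_flip (arms_return u mm win_b) _ => b c p ebc pm /(inv _ _ _ ebc pm)[bB p1].
  case=> [[_ [[_ dp]|[_ dp]]]|[E [[cu ?]|[cu ?]]]|[bu bv [[cu ?]|[_ ? _]]]]; try nlia.
  by split=> //; [rewrite !inE bu bv|nlia].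
have inv' b c p : e b c -> p <= m -> [/\ b \in B, p <= 1 & thread_dist u v 4 b c p = d] ->
    [/\ b \in B :\ u :\ v, p <= 1, (d %% m == 4) || (d %% m == m - 4) = (p == 0) &
     0 < p -> c != u].
  move=> ebc pm /(inv _ _ _ ebc pm)[bB p1].
  case=> [[_ [[_ dp]|[_ dp]]]|[E [[cu ?]|[cu ?]]]|[bu bv H]]; try nlia.
  split=> //; first by rewrite !inE bu bv.
    case: H => [[_ dp]|[_ _ ->]] //; have [-> ->] : p = 0 /\ d = m + 4 by nlia.
    by rewrite modnDl modn_small ?eqxx //; nlia.
  by case: H => [[_ dp]|[]//]; nlia.
have [d_mod|d_mod] := boolP ((d %% m == 4) || (d %% m == m - 4)).
  apply: points_branches win_b _ => b c p ebc S_bcp; left.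
  have pm : p <= m by case: S_bcp => _ p1 _; nlia.
  have [bB p1] := inv' b c p ebc pm S_bcp.
  by rewrite d_mod => /esym/eqP.
apply: points_sub win_rest _ => b c p ebc pm /(inv' _ _ _ ebc pm)[bB p1].
rewrite (negPf d_mod) => /esym/negbT p0 cu.
have p_gt0 : 0 < p by rewrite lt0n.
by split; [|rewrite inE cu|rewrite p_gt0].
Qed.

(** The bound on the number of candidates for the other end, which is required when
    one end [v] is found in round [s], is met for different reasons: in the case
    [m <= k], because [s < m]; if [B] is independent, because the neighbours of [v]
    are outside [B]; otherwise because the first probe deals with two vertices. *)
Lemma branches_next (B : {set V}) : #|B| = k.+1 -> winning (branches B).
Proof.
move=> Bk; have [v vB] : exists v, v \in B by apply/card_gt0P; rewrite Bk.
have cardB : #|B| = #|B :\ v|.+1 by rewrite (cardsD1 v) vB.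
have win_b : winning (branches (B :\ v)) by apply: win_small; nlia.
have dis : [disjoint B :\ v & [set v]].
  by rewrite disjoint_sym disjoints_subset; apply/subsetP => x; rewrite !inE => ->.
have found w (C : {set V}) : #|[set c in C | e w c]| + 2 < 2 * m + k ->
    winning (points (arms w 1 C)).
  by move=> Cle; apply: (@found_winning k _ _ 1) => //; nlia.
have all_nbrs w : [set c in [set: V] | e w c] = [set c in ~: set0 | e w c].
  by apply/setP => c; rewrite !inE.
have [large|small] := leqP m k.
  apply: (branches_probe vB win_b) => [|d _].
    apply: found; rewrite all_nbrs; have := @card_nbrs v set0; rewrite !inE cards0.
    by move=> /(_ isT); nlia.
  have win : winning (points (departed (B :\ v) [set v] 1)).
    by apply: departed_large => //; rewrite ?cards1; nlia.
  by apply: points_sub win _ => b c p _ _ [].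
have [indB|] := boolP [forall x in B, forall y in B, ~~ e x y].
  have ind : {in B &, forall x y, ~~ e x y}.
    by move=> x y xB yB; apply: (forall_inP (forall_inP indB x xB)).
  have out w c : w \in B -> e w c -> c \in ~: B.
    by move=> wB; rewrite inE; apply: contraL => cB; apply: ind.
  have cardCB := cardsC B.
  apply: (branches_probe vB win_b) => [|d _].
    apply: found; have : #|[set c in [set: V] | e v c]| <= #|~: B|.
      by apply/subset_leq_card/subsetP => c; rewrite 2!inE => /out->.
    by nlia.
  have win : winning (points (departed (B :\ v) [set v] 1)).
    apply: departed_winning => //; [nlia|nlia|nlia|left].
    split; first by move=> x y /setD1P[_ xB] /setD1P[_ yB]; apply: ind.
    by exists (~: B) => [|w /setD1P[_ wB] c]; [nlia|apply: out].
  by apply: points_sub win _ => b c p _ _ [].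
rewrite negb_forall_in => /exists_inP[x xB]; rewrite negb_forall_in.
case/exists_inP=> y yB; rewrite negbK => exy; have xy := edge_neq exy.
have cardB' := card_rest xy xB yB.
have found' w z : w != z -> winning (points (arms w 1 (~: [set z]))).
  move=> wz; apply: found; have := @card_nbrs w [set z].
  by rewrite inE wz cards1 => /(_ isT); nlia.
apply: (branches_pair xB yB exy).
- exact: found'.
- by apply: found'; rewrite eq_sym.
- by apply: win_small; nlia.
apply: departed_winning => //; [nlia| |nlia|nlia|right; rewrite cards1; nlia].
by rewrite disjoint_sym disjoints_subset; apply/subsetP => z; rewrite !inE => ->; rewrite andbF.
Qed.

End SmallSets.

Lemma branches_winning (B : {set V}) : winning (branches B).
Proof.
have [n] := ubnP #|B|; elim: n B => // n IH B Bn.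
have [B1|B2] := leqP #|B| 1; first exact: branches_one.
apply: (@branches_next #|B|.-1) => [|A Ak|]; [nlia| |nlia].
by apply: IH; nlia.
Qed.

Lemma subdivision_locatable : locatable (subdiv_rel e m).
Proof.
have /card_gt1P[v [w [_ _ vw]]] := V_gt1.
apply: Win_locatable.
  apply/card_gt1P; exists (inl v), (inl w); split=> //.
have [z evz] := has_nbr v.
apply: (@Win_probe _ _ _ (pt v z 0)) => d.
have win : winning (points (fun b c p => end_dist v b c p = d)).
  have [d_mod|d_mod] := boolP (d %% m == 0).
    apply: (@points_sub _ (fun b c p => p = 0 \/ p = m)).
      apply: points_branches (branches_winning [set: V]) _ => b c p _.
      by case=> ->; [left|right]; rewrite inE.
    move=> b c p _ pm dE; move: d_mod; rewrite -dE end_dist_branch //.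
    by case/orP=> /eqP->; auto.
  have vT : v \notin set0 by rewrite inE.
  apply: points_sub (off_winning vT (branches_winning _)) _ => b c p _ pm dE.
  move: d_mod; rewrite -dE end_dist_branch // => /norP[p0 p_m].
  by split; rewrite ?inE // lt0n p0 ltn_neqAle p_m.
apply: Win_sub win _ => y [dE _].
have [b [c [p [ebc pm yE]]]] : exists b c p, [/\ e b c, p <= m & y = pt b c p].
  case: (pt_surj y) => [[b ->]|[b [c [p [ebc pm ->]]]]].
    by have [c ebc] := has_nbr b; exists b, c, 0; rewrite pt0.
  by exists b, c, p; split=> //; apply: ltnW; case/andP: pm.
exists b, c, p; split=> //.
by rewrite -dE yE gdist_pt // -(thread_dist0 evz).
Qed.

End Subdivided.

Theorem theorem7 (V : finType) (e : rel V)
    (e_sym : symmetric e) (e_irr : irreflexive e)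
    (e_conn : connected_graph e) (n_ge23 : 23 <= #|V|)
    (m : nat) (m_ge : #|V| <= 2 * m) :
  locatable (subdiv_rel e m).
Proof.
by apply: subdivision_locatable => //; [lia|exact: leq_trans n_ge23].
Qed.
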